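(* Let $I$ be a countable set and let $A\subset I\times I$ be a $(0,1)$-matrix with no zero rows. Let $O_A$ be the sub-C$^*$-algebra of $C^*(X_A,T_A)$ generated by the partial isometries $S_i$, $i\in I$. (i) If $\emptyset\notin\mathcal J_A$, then $O_A=C^*(X_A,T_A)$. (ii) If $\emptyset\in\mathcal J_A$, then $O_A=C^*(X_A\setminus\{(\emptyset;\emptyset)\},T_A)$, the latter being regarded as the ideal of $C^*(X_A,T_A)$ associated with the open invariant subset $X_A\setminus\{(\emptyset;\emptyset)\}$ of $X_A$.
   Context: A subset $A\subset I\times I$ is identified with its characteristic function, a $(0,1)$-matrix; $A$ has no zero rows if for every $i\in I$ there is $j\in I$ with $(i,j)\in A$. The space $X_A$. For $i\in I$ let $A_i=\{j\in I:(j,i)\in A\}$. Let $\mathcal J_A\subset\mathcal P(I)=\{0,1\}^I$ be the set of cluster points of $(A_i)_{i\in I}$ as $i\to\infty$ in the discrete set $I$, for the product topology: $J\in\mathcal J_A$ iff for all finite $E\subset J$ and $F\subset I\setminus J$ there are infinitely many $i\in I$ with $E\subset A_i$ and $F\cap A_i=\emptyset$ (so $\mathcal J_A=\emptyset$ if $I$ is finite). A finite path of length $r\ge0$ is $\alpha=(i_0,\dots,i_{r-1})\in I^r$ with $(i_k,i_{k+1})\in A$ for all $k$. $X_A$ is the set of terminal paths: a terminal path is either an infinite path $(i_0,i_1,\dots)$ with $(i_k,i_{k+1})\in A$ for all $k$, or a pair $(i_0,\dots,i_{r-1};J)$, $r\ge 0$, where $(i_0,\dots,i_{r-1})$ is a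 finite path, $J\in\mathcal J_A$, and $i_{r-1}\in J$ if $r\geq 1$ (for $r=0$ it is written $(\emptyset;J)$; thus $(\emptyset;\emptyset)$ is the empty path together with $J=\emptyset$). For a terminal path $x$ of length $\ge r$ put $I_r(x)=A_{i_r}$ if $x$ has length $>r$ ($i_r$ its entry of index $r$) and $I_r(x)=J$ if $x=(i_0,\dots,i_{r-1};J)$. $X_A$ has the coarsest topology for which all the sets $Z(\alpha)=\{x: x \text{ starts with }\alpha\}$ and $\{x\in Z(\alpha): j\in I_r(x)\}$ are open and closed ($\alpha$ a finite path of length $r\ge0$, $j\in I$); it is a compact, totally disconnected, second countable Hausdorff space. $T_A$ is the shift, defined on the set of terminal paths of length $\ge1$ by removing the first entry; it is a local homeomorphism from an open subset of $X_A$ onto an open subset. The point $(\emptyset;\emptyset)$, when it exists, is neither in the domain nor in the range of $T_A$. For a local homeomorphism $T$ from an open subset of a Hausdorff, second countable, locally compact space $X$ onto an open subset of $X$, $T^n$ is the $n$-fold composition on its natural domain, and $G(X,T)=\{(x,m-n,y): m,n\in\mathbf N, x\in\mathrm{dom}(T^m),y\in\mathrm{dom}(T^n),T^mx=T^ny\}$ with product $(x,k,y)(y,l,z)=(x,k+l,z)$, inverse $(x,k,y)^{-1}=(y,-k,x)$, and basic open sets $\{(x,m-n,y):(x,y)\in U\times V,T^mx=T^ny\}$ with $U,V$ open and $T^m|_U,T^n|_V$ injective. It is a Hausdorff étale locally compact groupoid; $C^*(X,T)=C^*(G(X,T))$ (full and reduced coincide). A compact open bisection is identified with its characteristic function in $C_c(G(X,T))\subset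 C^*(X,T)$. For $i\in I$, $S_i\in C^*(X_A,T_A)$ is (the characteristic function of) the compact open bisection $\{(x,1,T_Ax): x \text{ a terminal path starting with } i\}$. *)

(* Defs.v *)
From HB Require Import structures.
From mathcomp Require Import all_boot all_order all_algebra.
From mathcomp Require Import complex.
From mathcomp Require Import all_classical all_reals all_analysis.

Set Implicit Arguments.
Unset Strict Implicit.
Unset Printing Implicit Defensive.

Import Order.TTheory GRing.Theory Num.Theory.
Import numFieldNormedType.Exports.

Local Open Scope classical_set_scope.
Local Open Scope ring_scope.

(* The algebra is not assumed to be unital, whence a multiplication [cmul]
   which is not the one of a MathComp ring. *)
HB.mixin Record isCstarAlgebra (R : realType) B
    & CompleteNormedModule R[i] B := {
  cmul : B -> B -> B;
  cstar : B -> B;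
  cmulA : forall x y z, cmul x (cmul y z) = cmul (cmul x y) z;
  cmulDl : forall x y z, cmul (x + y) z = cmul x z + cmul y z;
  cmulDr : forall x y z, cmul x (y + z) = cmul x y + cmul x z;
  cmulZl : forall (a : R[i]) x y, cmul (a *: x) y = a *: cmul x y;
  cmulZr : forall (a : R[i]) x y, cmul x (a *: y) = a *: cmul x y;
  cstarK : forall x, cstar (cstar x) = x;
  cstarD : forall x y, cstar (x + y) = cstar x + cstar y;
  cstarZ : forall (a : R[i]) x, cstar (a *: x) = a^* *: cstar x;
  cstarM : forall x y, cstar (cmul x y) = cmul (cstar y) (cstar x);
  norm_cmul : forall x y, `|cmul x y| <= `|x| * `|y|;
  norm_cstar_cmul : forall x, `|cmul (cstar x) x| = `|x| ^+ 2
}.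

#[short(type="cstarAlgebraType")]
HB.structure Definition CstarAlgebra (R : realType) :=
  {B of CompleteNormedModule R[i] B & isCstarAlgebra R B}.

Record star_homomorphism (R : realType) (B D : cstarAlgebraType R)
    (phi : B -> D) : Prop := {
  star_homD : forall x y, phi (x + y) = phi x + phi y;
  star_homZ : forall (a : R[i]) x, phi (a *: x) = a *: phi x;
  star_homM : forall x y, phi (cmul x y) = cmul (phi x) (phi y);
  star_homV : forall x, phi (cstar x) = cstar (phi x)
}.

Record sub_cstar_algebra (R : realType) (B : cstarAlgebraType R)
    (M : set B) : Prop := {
  subcs_closed : closed M;
  subcs0 : M 0;
  subcsD : forall x y, M x -> M y -> M (x + y);
  subcsZ : forall (a : R[i]) x, M x -> M (a *: x);
  subcsM : forall x y, M x -> M y -> M (cmul x y);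
  subcsV : forall x, M x -> M (cstar x)
}.

Definition generated_cstar (R : realType) (B : cstarAlgebraType R)
    (S : set B) : set B := smallest (@sub_cstar_algebra R B) S.

(* A partially defined map T on X is an [X -> option X]. *)
Definition piter (X : Type) (T : X -> option X) (n : nat) (x : X) : option X :=
  iter n (obind T) (Some x).

(* T^m x = T^n y, both sides being defined *)
Definition piter_meet (X : Type) (T : X -> option X) (m n : nat) (x y : X) :=
  exists z, piter T m x = Some z /\ piter T n y = Some z.

Record gpd (X : Type) (T : X -> option X) := Gpd {
  rg : X;
  deg : int;
  sr : X;
  gpdP : exists m n : nat, deg = m%:Z - n%:Z /\ piter_meet T m n rg sr
}.

HB.instance Definition _ (X : Type) (T : X -> option X) := gen_eqMixin (gpd T).
HB.instance Definition _ (X : Type) (T : X -> option X) :=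
  gen_choiceMixin (gpd T).

Definition gpd_mul (X : Type) (T : X -> option X) (a b c : gpd T) : Prop :=
  [/\ sr a = rg b, rg c = rg a, sr c = sr b & deg c = deg a + deg b].

Lemma gpd_inv_proof (X : Type) (T : X -> option X) (g : gpd T) :
  exists m n : nat, - deg g = m%:Z - n%:Z /\ piter_meet T m n (sr g) (rg g).
Proof.
case: (gpdP g) => m [n [-> [z [h1 h2]]]].
by exists n, m; split; [rewrite opprB | exists z].
Qed.

Definition gpd_inv (X : Type) (T : X -> option X) (g : gpd T) : gpd T :=
  Gpd (gpd_inv_proof g).

Definition piter_inj_on (X : Type) (T : X -> option X) (n : nat) (U : set X) :=
  forall x y z, U x -> U y -> piter T n x = Some z -> piter T n y = Some z ->
    x = y.

Definition gpd_basic_open (X : topologicalType) (T : X -> option X) :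
    set (set (gpd T)) :=
  [set W | exists (m n : nat) (U V : set X),
    [/\ open U, open V, piter_inj_on T m U, piter_inj_on T n V &
        W = [set g | [/\ U (rg g), V (sr g), deg g = m%:Z - n%:Z &
                         piter_meet T m n (rg g) (sr g)]]]].

HB.instance Definition _ (X : topologicalType) (T : X -> option X) :=
  isSubBaseTopological.Build (gpd T) (@gpd_basic_open X T) id.

Section groupoid_algebra.
Context (R : realType) (X : topologicalType) (T : X -> option X).

Definition Cc : set (gpd T -> R[i]) :=
  [set f | continuous (f : gpd T -> R[i]^o) /\
           compact (closure [set g | f g != 0])].

(* The sum has finitely many nonzero terms for f and g in [Cc]. *)
Definition convol (f g : gpd T -> R[i]) : gpd T -> R[i] := fun c =>
  \sum_(p \in [set p : gpd T * gpd T | gpd_mul p.1 p.2 c]) (f p.1 * g p.2).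

Definition invol (f : gpd T -> R[i]) : gpd T -> R[i] :=
  fun c => (f (gpd_inv c))^*.

(* Only the values of rho on [Cc] matter. *)
Record star_repr (D : cstarAlgebraType R) (rho : (gpd T -> R[i]) -> D) :
    Prop := {
  star_reprD : forall f g, Cc f -> Cc g ->
    rho (fun c => f c + g c) = rho f + rho g;
  star_reprZ : forall (a : R[i]) f, Cc f -> rho (fun c => a * f c) = a *: rho f;
  star_reprM : forall f g, Cc f -> Cc g -> rho (convol f g) = cmul (rho f) (rho g);
  star_reprV : forall f, Cc f -> rho (invol f) = cstar (rho f)
}.

(* (B, iota) is a full C*-algebra C*(X, T): the enveloping C*-algebra of the
   *-algebra [Cc]. It is unique up to a unique isomorphism. *)
Record full_cstar (B : cstarAlgebraType R) (iota : (gpd T -> R[i]) -> B) :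
    Prop := {
  full_repr : star_repr iota;
  full_dense : closure (iota @` Cc) = [set: B];
  full_universal : forall (D : cstarAlgebraType R)
    (rho : (gpd T -> R[i]) -> D), star_repr rho ->
    exists2 phi : B -> D, star_homomorphism phi &
      forall f, Cc f -> phi (iota f) = rho f
}.

End groupoid_algebra.
Arguments Cc {R X T}.

(* The image of x must lie in U, so this is the restriction of T to U when U
   is invariant. *)
Definition prestrict (X : choiceType) (T : X -> option X) (U : set X)
    (u : set_type U) : option (set_type U) :=
  obind insub (T (set_val u)).

Lemma piter_prestrict (X : choiceType) (T : X -> option X) (U : set X) (n : nat)
    (u w : set_type U) :
  piter (@prestrict X T U) n u = Some w ->
  piter T n (set_val u) = Some (set_val w).
Proof.
rewrite /piter; elim: n w => [|n IHn] w /=; first by case=> ->.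
case e: (iter n _ _) => [v|//] /=; rewrite (IHn _ e) /= /prestrict.
by case: (T _) => [y|//] /=; case: insubP => // z _ <- [->].
Qed.

Lemma gpd_incl_proof (X : choiceType) (T : X -> option X) (U : set X)
    (g : gpd (@prestrict X T U)) :
  exists m n : nat, deg g = m%:Z - n%:Z /\
    piter_meet T m n (set_val (rg g)) (set_val (sr g)).
Proof.
case: (gpdP g) => m [n [-> [z [h1 h2]]]]; exists m, n; split=> //.
by exists (set_val z); split; apply: piter_prestrict.
Qed.

Definition gpd_incl (X : choiceType) (T : X -> option X) (U : set X)
    (g : gpd (@prestrict X T U)) : gpd T := Gpd (gpd_incl_proof g).

(* Extension by zero: [gpd_incl] is injective, so that the sum has at most one
   term. *)
Definition extend0 (R : realType) (X : choiceType) (T : X -> option X)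
    (U : set X) (f : gpd (@prestrict X T U) -> R[i]) : gpd T -> R[i] :=
  fun g => \sum_(h \in @gpd_incl X T U @^-1` [set g]) f h.

(* For U open and invariant, C*(U, T) as an ideal of C*(X, T): the closure in
   C*(X, T) of the functions in C_c(G(U, T)) extended by zero to G(X, T). *)
Definition cstar_ideal (R : realType) (X : topologicalType) (T : X -> option X)
    (B : cstarAlgebraType R) (iota : (gpd T -> R[i]) -> B) (U : set X) :
    set B :=
  closure [set iota (extend0 f) |
            f in (Cc : set (gpd (@prestrict X T U) -> R[i]))].

Section terminal_paths.
Context (I : Type) (A : rel I).

Definition column (i : I) : set I := [set j | A j i].

Definition JA : set (set I) :=
  [set J | forall E F : set I, finite_set E -> finite_set F ->
     E `<=` J -> F `<=` ~` J ->
     infinite_set [set i | E `<=` column i /\ F `&` column i = set0]].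

Inductive tpath :=
| InfPath (p : nat -> I) of forall k, A (p k) (p k.+1)
| FinPath (s : seq I) (J : set I) of
    sorted A s & JA J & (if s is i :: s' then J (last i s') else True).

HB.instance Definition _ := gen_eqMixin tpath.
HB.instance Definition _ := gen_choiceMixin tpath.

Definition entry (x : tpath) (k : nat) : option I :=
  match x with
  | InfPath p _ => Some (p k)
  | FinPath s _ _ _ _ => onth s k
  end.

Definition starts_with (alpha : seq I) : set tpath :=
  [set x | forall k, (k < size alpha)%N -> entry x k = onth alpha k].

(* Meaningful when x has length at least r. *)
Definition Iset (r : nat) (x : tpath) : set I :=
  match x with
  | InfPath p _ => column (p r)
  | FinPath s J _ _ _ => if onth s r is Some i then column i else J
  end.

Definition tpath_clopen : set (set tpath) :=
  [set W | exists2 alpha : seq I, sorted A alpha &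
     W = starts_with alpha \/
     exists j, W = starts_with alpha `&` [set x | Iset (size alpha) x j]].

HB.instance Definition _ := isSubBaseTopological.Build tpath
  [set W | tpath_clopen W \/ tpath_clopen (~` W)] id.

Lemma behead_last_proof (s : seq I) (J : set I) :
  (if s is i :: s' then J (last i s') else True) ->
  if behead s is i :: s' then J (last i s') else True.
Proof. by case: s => // i [|j s]. Qed.

Lemma behead_sorted_proof (s : seq I) : sorted A s -> sorted A (behead s).
Proof. by case: s => // i s; apply: path_sorted. Qed.

Definition tpath_shift (x : tpath) : option tpath :=
  match x with
  | InfPath p Hp => Some (InfPath (p := fun k => p k.+1) (fun k => Hp k.+1))
  | FinPath s J Hs HJ Hl =>
      if s is [::] then None
      else Some (FinPath (behead_sorted_proof Hs) HJ (behead_last_proof Hl))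
  end.

Definition empty_tpath (h : JA set0) : tpath :=
  @FinPath [::] set0 isT h Logic.I.

Definition S_bisection (i : I) : set (gpd tpath_shift) :=
  [set g | [/\ starts_with [:: i] (rg g), deg g = 1 &
               tpath_shift (rg g) = Some (sr g)]].

End terminal_paths.

(* iota is meant to be the canonical map C_c(G(X_A, T_A)) -> C*(X_A, T_A). *)
Definition OA (R : realType) (I : Type) (A : rel I) (B : cstarAlgebraType R)
    (iota : (gpd (@tpath_shift I A) -> R[i]) -> B) : set B :=
  generated_cstar [set iota \1_(@S_bisection I A i) | i in [set: I]].

(* Main.v *)
Require Import Defs.
From mathcomp Require Import all_boot all_order all_algebra.
From mathcomp Require Import complex finmap zify ring lra.
From mathcomp Require Import all_classical all_reals all_analysis.

Set Implicit Arguments.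
Unset Strict Implicit.
Unset Printing Implicit Defensive.

Import Order.TTheory GRing.Theory Num.Theory.
Import numFieldNormedType.Exports.

Local Open Scope classical_set_scope.
Local Open Scope ring_scope.

(* Write S_a = S_(a_1) ... S_(a_m) for a finite path a. The products S_a P S_b^*,
   where P is a product of projections S_j^* S_j, are the characteristic functions
   of compact open bisections of the groupoid. Those which are not the unit
   (a, b and P all empty) lie in O_A, and their closed span is stable under left
   multiplication by the S_i and S_i^*, so that this span is O_A.

   These bisections cover the points of the groupoid whose range is not the empty
   path, and the sets of terminal paths on which multiplication by the
   characteristic function preserves O_A form a Boolean algebra containing the
   subbase of the topology. Hence a continuous function with compact support away
   from the empty path is cut into functions supported in one bisection W, each of
   which is a uniform limit of step functions supported in W and lying in O_A.

   Uniform convergence on W implies norm convergence: a real function v on W with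
   |v| <= 1 is the mean of the functions u = v +- i sqrt(1 - v^2) of modulus one on W,
   and u^* u = 1_W^* 1_W, so that u and 1_W have the same norm.

   When the empty path is not a point, this handles all of C_c; when it is, it
   handles the functions extended by zero from its complement. *)

(** * Terminal paths *)

Definition is_subbase (T : topologicalType) (D : set (set T)) : Prop :=
  forall O, open O <->
    exists2 D' : set (set T), D' `<=` finI_from D id & \bigcup_(i in D') i = O.

Lemma subbase_open (T : topologicalType) (D : set (set T)) (W : set T) :
  is_subbase D -> D W -> open W.
Proof.
move=> hD DW; apply/hD; exists [set W]; last exact: bigcup_set1.
by move=> _ ->; exact: (@finI_from1 _ _ D id W).
Qed.

(** A family [P] closed in this way contains all finite intersections of subbasic sets, hence a
    basis. It will consist, for instance, of the sets along which functions can be cut within O_A,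
    or of the sets with open image. *)
Lemma subbase_nbhs (T : topologicalType) (D P : set (set T)) (x : T) (O : set T) :
  is_subbase D -> P setT -> (forall U V, P U -> P V -> P (U `&` V)) ->
  D `<=` P -> nbhs x O -> exists C, [/\ P C, C x & C `<=` O].
Proof.
move=> hD PT PI DP; rewrite nbhsE => -[V [/hD[D' D'D <-] [C D'C Cx]] VO].
exists C; split=> //; last by move=> y Cy; apply: VO; exists C.
have [K KD <-] := D'D _ D'C; rewrite bigcap_fset.
rewrite big_seq; elim/big_ind : _ => // W WK.
by apply: DP; have := KD _ WK; rewrite inE.
Qed.

Lemma subbase_cvg (T : topologicalType) (D : set (set T)) (F : set_system T) (x : T) :
  is_subbase D -> Filter F -> (forall W, D W -> W x -> F W) -> F --> x.
Proof.
move=> hD FF DF O /= Ox.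
have [||W DW Wx|C [CF Cx CO]] := @subbase_nbhs T D [set C | C x -> F C] x O hD _ _ _ Ox.
- by move=> _; exact: filterT.
- by move=> U V hU hV [Ux Vx]; apply: filterI; [exact: hU|exact: hV].
- exact: DF.
- by apply: filterS CO _; exact: CF.
Qed.

Lemma subbase_continuous (S T : topologicalType) (D : set (set T)) (f : S -> T) :
  is_subbase D -> (forall W, D W -> open (f @^-1` W)) -> continuous f.
Proof.
move=> hD Df x; apply: (subbase_cvg hD) => W DW Wfx.
by apply: open_nbhs_nbhs; split=> //; exact: Df.
Qed.

Lemma ultra_fmap (S T : Type) (f : S -> T) (F : set_system S) :
  UltraFilter F -> UltraFilter (f @ F).
Proof.
move=> FU; split=> [|G GF FG]; first exact: fmap_proper_filter.
rewrite eqEsubset; split=> // W GW; rewrite /fmap /=.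
have [//|FnW] := in_ultra_setVsetC (f @^-1` W) FU.
have : G (~` W) by apply: FG.
by move=> /(filterI GW); rewrite setICr => /filter_not_empty.
Qed.

Lemma ultra_notC (T : Type) (F : set_system T) (W : set T) :
  UltraFilter F -> ~ F W -> F (~` W).
Proof. by move=> FU nW; have [] := in_ultra_setVsetC W FU. Qed.

(** * Entries, sets [Iset] and cylinders of terminal paths *)

Section tpath_space.
Context (I : choiceType) (A : rel I).
Implicit Types (x y z : tpath A) (a b : seq I) (e : seq I) (i j : I) (n k : nat).

Lemma entry_None x k n : (k <= n)%N -> entry x k = None -> entry x n = None.
Proof.
case: x => //= s J _ _ _ kn sk; apply: onth_default; apply: leq_trans kn.
by rewrite -onthNE sk.
Qed.

Lemma entry_Some x k n i : (k <= n)%N -> entry x n = Some i -> exists j,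
  entry x k = Some j.
Proof.
move=> kn xn; case xk: (entry x k) => [j|]; first by exists j.
by rewrite (entry_None kn xk) in xn.
Qed.

Lemma Iset_entry x k i : entry x k = Some i -> Iset k x = column A i.
Proof. by case: x => [p Hp|s J Hs HJ Hl] /=; [case=> <-|move=> ->]. Qed.

Lemma onth_lastP (s : seq I) k i :
  onth s k = Some i -> onth s k.+1 = None -> forall i0, last i0 s = i.
Proof.
elim: s k i => [|i1 s IHs] [|k] i //=; last by move=> h1 h2 i0; exact: IHs h1 h2 _.
by case=> <-; case: s {IHs}.
Qed.

(** Inside the path this is the edge relation between consecutive entries; at the end of a finite
    path it is the requirement that the last entry belong to J. *)
Lemma Iset_last x k i : entry x k = Some i -> Iset k.+1 x i.
Proof.
case: x => [p Hp|s J Hs HJ Hl]; rewrite /entry /Iset; first by case=> <-; exact: Hp.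
case sk1: (onth s k.+1) => [j|] sk.
  rewrite /column /=; elim: s k sk sk1 Hs {Hl} => [|i0 [|i1 s] IHs] [|k] //=;
    rewrite ?onth0n //.
    by move=> [<-] [<-] /andP[].
  by move=> h1 h2 /andP[_]; exact: IHs h1 h2.
case: s Hs Hl sk sk1 => [|i0 s] _ Hl; first by rewrite onth0n.
by move=> /onth_lastP h /h /(_ i0) /= <-.
Qed.

Lemma Iset_JA x k : entry x k = None -> JA A (Iset k x).
Proof. by case: x => //= s J Hs HJ Hl ->. Qed.

Lemma entry_rel x k i j : entry x k = Some i -> entry x k.+1 = Some j -> A i j.
Proof. by move=> /Iset_last + /Iset_entry h; rewrite h. Qed.

(** The entries give the path, and [Iset] at the length of a finite path gives J; the remaining
    components are proofs. *)
Lemma tpath_ext x y :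
  (forall k, entry x k = entry y k) -> (forall k, Iset k x = Iset k y) -> x = y.
Proof.
case: x => [p Hp|s J Hs HJ Hl]; case: y => [q Hq|t K Ht HK Hm] /= he hI.
- have pq : p = q by apply/funext => k; have [] := he k.
  by rewrite -pq in Hq *; rewrite (Prop_irrelevance Hp Hq).
- by have := he (size t); rewrite onth_default.
- by have := he (size s); rewrite onth_default.
- have st : s = t by exact: eq_from_onth.
  have JK : J = K by have := hI (size s); rewrite -st onth_default.
  move: Ht HK Hm; rewrite -st -JK => Ht HK Hm.
  by rewrite (Prop_irrelevance Hs Ht) (Prop_irrelevance HJ HK) (Prop_irrelevance Hl Hm).
Qed.

Lemma tpath_subbase : @is_subbase (tpath A)
  [set W | tpath_clopen W \/ tpath_clopen (~` W)].
Proof. by move=> O; split. Qed.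

Lemma starts_with_rcons a i x :
  starts_with (rcons a i) x <-> starts_with a x /\ entry x (size a) = Some i.
Proof.
rewrite /starts_with /= size_rcons -cats1; split=> [h|[h xi] k].
  split=> [k ka|]; last by rewrite h // onth_cat ltnn subnn.
  by rewrite h ?onth_cat ?ka //; lia.
rewrite ltnS leq_eqVlt onth_cat => /predU1P[->|ka]; last by rewrite ka h.
by rewrite ltnn subnn.
Qed.

Lemma starts_with_catl a b x : starts_with (a ++ b) x -> starts_with a x.
Proof.
move=> h k ka; rewrite h ?size_cat; last by lia.
by rewrite onth_cat ka.
Qed.

Lemma starts_with_take a b x : (size a <= size b)%N ->
  starts_with a x -> starts_with b x -> a = take (size a) b.
Proof.
move=> ab xa xb; apply: eq_from_onth_le => k.
rewrite size_takel // maxnn => ka; rewrite -xa // xb; last by lia.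
by rewrite -{1}(cat_take_drop (size a) b) onth_cat size_takel // ka.
Qed.

Lemma starts_with_inj a b x : size a = size b ->
  starts_with a x -> starts_with b x -> a = b.
Proof.
by move=> ab xa /(starts_with_take _ xa); rewrite ab take_size => ->.
Qed.

Lemma starts_with_ex x n : (forall k, (k < n)%N -> entry x k != None) ->
  exists2 a, size a = n & starts_with a x.
Proof.
elim: n => [|n IHn] h; first by exists [::].
have [|a an xa] := IHn; first by move=> k kn; apply: h; lia.
case xn: (entry x n) => [i|]; last by have := h n (ltnSn n); rewrite xn.
by exists (rcons a i); rewrite ?size_rcons ?an //; apply/starts_with_rcons; rewrite an.
Qed.

Lemma starts_with_sorted a x : starts_with a x -> sorted A a.
Proof.
elim/last_ind: a => // a i IHa /starts_with_rcons[xa xi].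
case/lastP: a xa xi {IHa} (IHa xa) => // a j /starts_with_rcons[_ xj].
rewrite size_rcons => xi; rewrite -!cats1 => srt.
case: a srt xj xi => [_ xj xi|i0 a] /=.
  by rewrite (entry_rel xj xi).
by rewrite !cat_path /= last_cat /= => /andP[-> /andP[-> _]] xj xi;
  rewrite (entry_rel xj xi).
Qed.

Lemma starts_with_defined a x k :
  starts_with a x -> (k < size a)%N -> entry x k != None.
Proof. by move=> xa ka; rewrite xa //; have := onthTE a k; rewrite ka; case: onth. Qed.

(* For x = a z, [Iset (size a) x j] says that j z is again a terminal path. *)
Definition cyl a e : set (tpath A) :=
  [set x | starts_with a x /\ forall j, j \in e -> Iset (size a) x j].

Lemma cyl0 a : cyl a [::] = starts_with a.
Proof. by apply/seteqP; split=> [x []|x xa]. Qed.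

Lemma cyl1 a j : cyl a [:: j] = starts_with a `&` [set x | Iset (size a) x j].
Proof.
apply/seteqP; split=> [x [xa h]|x [xa h]]; split=> //; first by apply: h; rewrite inE.
by move=> k; rewrite inE => /eqP ->.
Qed.

Lemma cyl_cons a j e : cyl a (j :: e) = cyl a [:: j] `&` cyl a e.
Proof.
apply/seteqP; split=> [x [xa h]|x [[xa h1] [_ h2]]].
  by split; split=> // k ke; apply: h; rewrite inE; [move: ke;
    rewrite inE => ->|rewrite ke orbT].
by split=> // k; rewrite inE => /predU1P[->|/h2 //]; apply: h1; rewrite inE.
Qed.

Lemma cyl_clopen a e : clopen (cyl a e).
Proof.
have h b j : clopen (starts_with b : set (tpath A)) /\ clopen (cyl b [:: j]).
  (* The subbase only mentions admissible words; any other word begins no terminal path. *)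
  have [srt|nsrt] := pselect (sorted A b); last first.
    have b0 : starts_with b = set0 :> set (tpath A).
      by apply/seteqP; split=> // x /starts_with_sorted.
    rewrite cyl1 b0 set0I; split; exact: clopen0.
  suff oc W : tpath_clopen W -> @clopen (tpath A) W.
    by split; apply: oc; exists b => //; [left|right; exists j; exact: cyl1].
  move=> cW; split; first by apply: (subbase_open tpath_subbase); left.
  by rewrite -openC; apply: (subbase_open tpath_subbase); right; rewrite setCK.
elim: e => [|j e IHe]; last by rewrite cyl_cons; apply: clopenI => //; exact: (h _ _).2.
(* [h] takes a letter as argument, so an empty alphabet is treated apart: its only word is empty and
   the cylinder is the whole space. *)
rewrite cyl0; have [j|nI] := pselect (exists j : I, True).
  by case: j => j _; case: (h a j).
case: a => [|j]; last by exfalso; apply: nI; exists j.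
suff -> : starts_with [::] = setT :> set (tpath A) by exact: clopenT.
exact/seteqP.
Qed.

End tpath_space.

(** * Iterates of a partial map, and the shift on terminal paths *)

Lemma piter_add (X : Type) (T : X -> option X) m n x y :
  piter T m x = Some y -> piter T (m + n) x = piter T n y.
Proof. by rewrite /piter addnC iterD => ->. Qed.

Lemma piter_split (X : Type) (T : X -> option X) m n x z :
  piter T (m + n) x = Some z -> exists2 y, piter T m x = Some y & piter T n y = Some z.
Proof.
move=> h; case e: (piter T m x) => [y|]; first by exists y => //;
  rewrite -h (piter_add _ e).
move: h; rewrite /piter addnC iterD; rewrite /piter in e; rewrite e.
have -> : iter n (obind T) None = None by elim: n => //= n ->.
by [].
Qed.

Lemma piterS (X : Type) (T : X ->
  option X) n x : piter T n.+1 x = obind (T) (piter T n x).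
Proof. by []. Qed.

Lemma piterSr (X : Type) (T : X -> option X) n x y :
  T x = Some y -> piter T n.+1 x = piter T n y.
Proof. by move=> xy; rewrite -add1n; apply: piter_add. Qed.

Section tpath_shift.
Context (I : choiceType) (A : rel I).
Implicit Types (x y z : tpath A) (a b : seq I) (e : seq I) (i j : I) (n k : nat).
Local Notation T := (@tpath_shift I A).

(** Past the end of a finite path [Iset] keeps the value J, so indices beyond the length carry no
    new information. *)
Lemma Iset_None x k n : (k <= n)%N -> entry x k = None -> Iset n x = Iset k x.
Proof.
case: x => //= s J _ _ _ kn sk; rewrite sk onth_default //; apply: leq_trans kn.
by rewrite -onthNE sk.
Qed.

(** Cylinders without condition determine the entries. For a finite path the cylinders of the whole
    path with one condition j then determine J. *)
Lemma cyl_separated x y : (forall a e, cyl a e x <-> cyl a e y) -> x = y.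
Proof.
move=> h.
have ent (u v : tpath A) k i : (forall a e, cyl a e u <-> cyl a e v) ->
    entry u k = Some i -> entry v k = Some i.
  move=> uv uk; have [|a ak ua] := @starts_with_ex _ _ u k.+1.
    by move=> l lk; have [j ->] := @entry_Some _ _ u l k i lk uk.
  have /uv[va _] : cyl a [::] u by rewrite cyl0.
  by rewrite -uk va ?ua ?ak.
have enteq k : entry x k = entry y k.
  case xk: (entry x k) => [i|]; first by rewrite (ent _ _ _ _ h xk).
  case yk: (entry y k) => [i|] //.
  by rewrite (ent _ _ _ _ (fun a e => iff_sym (h a e)) yk) in xk.
apply: tpath_ext => // n; case xn: (entry x n) => [i|].
  by rewrite (Iset_entry xn); rewrite enteq in xn; rewrite (Iset_entry xn).
have ex : exists k, entry x k == None by exists n; rewrite xn.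
(* The first missing index r is the length of x, and also that of y. *)
case: (ex_minnP ex) => r /eqP xr rmin.
have rn : (r <= n)%N by apply: rmin; rewrite xn.
have yr : entry y r = None by rewrite -enteq.
rewrite (Iset_None rn xr) (Iset_None rn yr).
have [|a ar xa] := @starts_with_ex _ _ x r.
  by move=> k kr; apply/negP => /rmin; rewrite leqNgt kr.
have ya : starts_with a y by rewrite -cyl0; apply/h; rewrite cyl0.
apply/seteqP; split=> j jr.
  have /h : cyl a [:: j] x by rewrite cyl1 /= ar.
  by rewrite cyl1 ar => -[].
have /h : cyl a [:: j] y by rewrite cyl1 /= ar.
by rewrite cyl1 ar => -[].
Qed.

Lemma tpath_hausdorff : hausdorff_space (tpath A).
Proof.
move=> x y xy; apply: cyl_separated => a e.
have [oc cc] := cyl_clopen A a e; rewrite -openC in cc.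
split=> [ax|ay]; apply: contrapT => na.
  have [||z [az naz]] := xy (cyl a e) (~` cyl a e); [| |exact: naz az].
    exact: open_nbhs_nbhs.
  exact: open_nbhs_nbhs.
have [||z [naz az]] := xy (~` cyl a e) (cyl a e); [| |exact: naz az].
  exact: open_nbhs_nbhs.
exact: open_nbhs_nbhs.
Qed.

Lemma tpath_cvg (F : set_system (tpath A)) x : UltraFilter F ->
  (forall a e, F (cyl a e) <-> cyl a e x) -> F --> x.
Proof.
move=> FU h; apply: (subbase_cvg (@tpath_subbase _ A)) => W DW.
have cle (V : set (tpath A)) : tpath_clopen V -> exists a e, V = cyl a e.
  case=> a _ [->|[j ->]]; first by exists a, [::]; rewrite cyl0.
  by exists a, [:: j]; rewrite cyl1.
case: DW => [/cle[a [e ->]] /h //|/cle[a [e aW]] Wx].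
have [//|] := in_ultra_setVsetC W FU.
by rewrite aW => /h; rewrite -aW.
Qed.

Lemma shift_entry x z : T x = Some z ->
  (forall k, entry z k = entry x k.+1) /\ (forall k, Iset k z = Iset k.+1 x).
Proof.
case: x => [p Hp [<-]|[|i s] J Hs HJ Hl] //= [<-]; split=> k //=; by rewrite /= ?drop0.
Qed.

Lemma shift_None x : T x = None <-> entry x 0 = None.
Proof. by case: x => [p Hp|[|i s] J Hs HJ Hl]. Qed.

Lemma piter_entry n x z : piter T n x = Some z ->
  (forall k, entry z k = entry x (n + k)) /\ (forall k, Iset k z = Iset (n + k) x).
Proof.
elim: n z => [z [<-] //|n IHn z]; rewrite piterS; case e: (piter T n x) => [y|//] /= yz.
have [h1 h2] := IHn _ e; have [h3 h4] := shift_entry yz.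
by split=> k; rewrite ?h3 ?h4 ?h1 ?h2 addSnnS.
Qed.

Lemma piter_defined n x : (forall k, (k < n)%N -> entry x k != None) ->
  exists z, piter T n x = Some z.
Proof.
elim: n => [_|n IHn h]; first by exists x.
have [k kn|z xz] := IHn; first by apply: h; lia.
rewrite piterS xz /=; case zz: (T z) => [y|]; first by exists y.
have := h n (ltnSn n); rewrite -[in entry x n](addn0 n) -(piter_entry xz).1.
by rewrite (shift_None _).1.
Qed.

Lemma piter_entry_defined n x z k : piter T n x = Some z -> (k < n)%N ->
  entry x k != None.
Proof.
move=> h kn; have nE : n = (k + (1 + (n - k.+1)))%N by lia.
rewrite nE in h; have [y xy yz] := piter_split h.
have [w yw _] := piter_split yz; apply/eqP => xk.
suff : T y = None by rewrite -[T y]/(piter T 1 y) yw.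
by apply/shift_None; rewrite (piter_entry xy).1 addn0.
Qed.

Lemma piter_starts n x z : piter T n x = Some z -> exists2 a, size a = n &
  starts_with a x.
Proof. by move=> xz; apply: starts_with_ex => k; exact: piter_entry_defined xz. Qed.

Lemma starts_piter a x : starts_with a x -> exists z, piter T (size a) x = Some z.
Proof. by move=> xa; apply: piter_defined => k; exact: starts_with_defined. Qed.

(** A path a z is recovered from a and z. *)
Lemma starts_piter_inj a : piter_inj_on T (size a) (starts_with a).
Proof.
move=> x y z xa ya xz yz.
have ent k : entry x k = entry y k.
  have [ka|ka] := ltnP k (size a); first by rewrite xa ?ya.
  by rewrite -(subnKC ka) -(piter_entry xz).1 -(piter_entry yz).1.
apply: tpath_ext => // k.
have [ka|ka] := ltnP k (size a); last first.
  by rewrite -(subnKC ka) -(piter_entry xz).2 -(piter_entry yz).2.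
case xk: (entry x k) => [i|]; last by have := starts_with_defined xa ka; rewrite xk.
by rewrite (Iset_entry xk); rewrite ent in xk; rewrite (Iset_entry xk).
Qed.

Lemma starts_with_tl a b x z : starts_with a x -> piter T (size a) x = Some z ->
  starts_with (a ++ b) x <-> starts_with b z.
Proof.
move=> xa xz; have [ent _] := piter_entry xz.
split=> h k kb.
  rewrite ent h ?size_cat; last by lia.
  by rewrite onth_cat ltnNge leq_addr /= addKn.
move: kb; rewrite size_cat onth_cat; have [ka _|ka kb] := ltnP k (size a);
  first exact: xa.
by rewrite -{1}(subnKC ka) -ent h //; lia.
Qed.

Lemma cyl_cat a b e x z : starts_with a x -> piter T (size a) x = Some z ->
  cyl b e z <-> cyl (a ++ b) e x.
Proof.
move=> xa xz; rewrite /cyl /= (starts_with_tl b xa xz).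
by split=> -[h1 h2]; split=> // j /h2; rewrite (piter_entry xz).2 size_cat.
Qed.

(** The hypothesis is the edge from i to the first entry of x if there is one, and the membership of
    i in J otherwise: just what i x needs to be a terminal path. *)
Lemma tcons_ex i x : Iset 0 x i -> exists y, entry y 0 = Some i /\ T y = Some x.
Proof.
case: x => [p Hp|s J Hs HJ Hl] /= h.
  have Hq k : A ((fun k => if k is l.+1 then p l else i) k) (p k) by case: k.
  by exists (InfPath Hq); split=> //=; congr Some; apply: tpath_ext.
have Ht : sorted A (i :: s) by case: s Hs Hl h => //= i0 s -> _ ->.
have Hm : J (last i s) by case: s Hs Hl h Ht => // i0 s _.
exists (@FinPath _ _ (i :: s) J Ht HJ Hm); split=> //=; congr Some.
by apply: tpath_ext => k //=; rewrite drop0.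
Qed.

End tpath_shift.

(** * Compactness of the space of terminal paths, by convergence of ultrafilters *)

Section tpath_compact.
Context (I : choiceType) (A : rel I) (F : set_system (tpath A)).
Context (FU : UltraFilter F).
Implicit Types (x y z : tpath A) (a b : seq I) (e : seq I) (i j : I) (n k : nat).

Lemma ultra_cyl_reduce x :
  (forall a, F (starts_with a) <-> starts_with a x) ->
  (forall a j, F (cyl a [:: j]) <-> cyl a [:: j] x) ->
  F --> x.
Proof.
move=> h0 h1; apply: tpath_cvg => a e; elim: e => [|j e IHe]; first by rewrite cyl0.
rewrite cyl_cons; split=> [h|[/h1 hj /IHe he]]; last exact: filterI.
by split; [apply/h1|apply/IHe]; apply: filterS h => y [].
Qed.

(** The limit is the infinite path spelled by the words [w n]. Whether a cylinder of a with
    condition j belongs to F is decided on [w (size a).+1], whose last letter fixes [Iset] at index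
    [size a]. *)
Lemma ultra_infinite (p : nat -> I) (w : nat -> seq I) :
  (forall n, w n.+1 = rcons (w n) (p n)) -> w 0 = [::] ->
  (forall n, F (starts_with (w n))) -> exists x, F --> x.
Proof.
move=> wS w0 Fw.
have sw n : size (w n) = n by elim: n => [|n IHn]; rewrite ?w0 ?wS ?size_rcons ?IHn.
have ent x n : starts_with (w n.+1) x -> entry x n = Some (p n).
  by rewrite wS => /starts_with_rcons[_]; rewrite sw.
have Hp n : A (p n) (p n.+1).
  have [x xw] := filter_ex (Fw n.+2).
  have x1 := ent _ _ xw; move: xw; rewrite wS => /starts_with_rcons[/ent x0 _].
  exact: entry_rel x0 x1.
exists (InfPath Hp).
have onw n k : (k < n)%N -> onth (w n) k = Some (p k).
  elim: n => // n IHn; rewrite ltnS wS -cats1 onth_cat sw leq_eqVlt => /predU1P[->|kn].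
    by rewrite ltnn subnn.
  by rewrite kn IHn.
have xw n : starts_with (w n) (InfPath Hp) by move=> k; rewrite sw /= => /onw ->.
have h0 a : F (starts_with a) <-> starts_with a (InfPath Hp).
  split=> [Fa|xa].
    have [y [ya yw]] := filter_ex (filterI Fa (Fw (size a))).
    by rewrite (starts_with_inj _ ya yw) // sw.
  by rewrite (starts_with_inj _ xa (xw (size a))) ?sw.
apply: ultra_cyl_reduce => // a j; rewrite cyl1; split=> [Faj|[xa jx]].
  have [y [[ya yj] yw]] := filter_ex (filterI Faj (Fw (size a).+1)).
  split; last by move: yj; rewrite /= (Iset_entry (ent _ _ yw)).
  by apply/h0; apply: filterS Faj => ? [].
apply: filterS (filterI ((h0 a).2 xa) (Fw (size a).+1)) => y [ya /ent yw]; split=> //=.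
by rewrite (Iset_entry yw).
Qed.

(** F starts with a but with no longer word, so the limit has to be (a; J), with J the set of the j
    for which F contains the cylinder of a with condition j. *)
Lemma ultra_finite a : F (starts_with a) -> (forall i, ~ F (starts_with (rcons a i))) ->
  exists x, F --> x.
Proof.
move=> Fa Fai; pose J := [set j | F (cyl a [:: j])].
have srt : sorted A a by have [x /starts_with_sorted] := filter_ex Fa.
have HJ : JA A J.
  move=> E E' finE finE' EJ E'J finK.
  have FE : F [set x | forall j, E j -> Iset (size a) x j].
    have -> : [set x | forall j, E j -> Iset (size a) x j] =
      \bigcap_(j in [set` fset_set E]) [set x : tpath A | Iset (size a) x j].
      apply/seteqP; split=> x h j; first by rewrite /= in_fset_set // inE => /h.
      by move=> Ej; apply: h; rewrite /= in_fset_set // inE.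
    apply: filter_bigI => j; rewrite in_fset_set // inE => /EJ.
    by rewrite /J /= cyl1; apply: filterS => x [].
  have FE' : F [set x | forall j, E' j -> ~ Iset (size a) x j].
    have -> : [set x | forall j, E' j -> ~ Iset (size a) x j] =
      \bigcap_(j in [set` fset_set E']) [set x : tpath A | ~ Iset (size a) x j].
      apply/seteqP; split=> x h j; first by rewrite /= in_fset_set // inE => /h.
      by move=> Ej; apply: h; rewrite /= in_fset_set // inE.
    apply: filter_bigI => j; rewrite in_fset_set // inE => /E'J nj.
    have : F (~` cyl a [:: j]) by exact: ultra_notC.
    move=> /(filterI Fa); apply: filterS => x [xa]; rewrite cyl1.
    by apply: contra_not => ?.
  have FK : F [set x | forall i, E `<=` column A i /\ E' `&` column A i = set0 ->
      ~ starts_with (rcons a i) x].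
    set K := [set i | _] in finK.
    have -> : [set x | forall i, E `<=` column A i /\ E' `&` column A i = set0 ->
        ~ starts_with (rcons a i) x] =
      \bigcap_(i in [set` fset_set K]) ~` (starts_with (rcons a i) : set (tpath A)).
      apply/seteqP; split=> x h i; first by rewrite /= in_fset_set // inE => /h.
      by move=> Ki; apply: h; rewrite /= in_fset_set // inE.
    by apply: filter_bigI => i _; apply: ultra_notC.
  have [x [[xa xE] [xE' xK]]] := filter_ex (filterI (filterI Fa FE) (filterI FE' FK)).
  (* Either x continues with a letter i, which then lies in the finite set of columns excluded by
     [FK], or x stops after a, and its own set, a member of [JA], contradicts that finiteness. *)
  case xs: (entry x (size a)) => [i|].
    apply: (xK i); last exact/starts_with_rcons.
    move: xE xE'; rewrite /= (Iset_entry xs) => xE xE'; split=> //.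
    by apply/seteqP; split=> // j [/xE' + ?].
  by apply: (Iset_JA xs finE finE').
have Hl : (if a is i :: s then J (last i s) else True) : Prop.
  case ea : a => [//|i s].
  have as1 : onth a (size s) = Some (last i s).
    by rewrite ea; elim: s i {ea} => [//|j s IHs] i; exact: (IHs j).
  rewrite /J /= cyl1; apply: filterS Fa => x xa; split=> //=.
  by rewrite [X in Iset (size X)]ea; apply: Iset_last; rewrite xa // ea.
pose x := FinPath srt HJ Hl; exists x.
have xa : starts_with a x by [].
have xn : entry x (size a) = None by exact: onth_default.
have h0 b : F (starts_with b) <-> starts_with b x.
  have [ba|ab] := leqP (size b) (size a).
    split=> [Fb|xb].
      have [y [yb ya]] := filter_ex (filterI Fb Fa).
      by rewrite (starts_with_take ba yb ya);
        apply: (@starts_with_catl _ _ _ (drop (size b) a)); rewrite cat_take_drop.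
    rewrite (starts_with_take ba xb xa); apply: filterS Fa => y ya.
    by apply: (@starts_with_catl _ _ _ (drop (size b) a)); rewrite cat_take_drop.
  split=> [Fb|/starts_with_defined/(_ ab)]; last by rewrite xn.
  exfalso; case bs: (onth b (size a)) => [i|]; last first.
    by have := onthTE b (size a); rewrite bs ab.
  by apply: (Fai i); apply: filterS (filterI Fb Fa) => y [yb ya];
    apply/starts_with_rcons; rewrite yb.
apply: ultra_cyl_reduce => // b j.
(* If b is shorter than a, the next letter of a decides; if b is longer, both sides fail; if the
   lengths agree, then b = a and the claim is the definition of J. *)
have [ba|ab|ba] := ltngtP (size b) (size a).
- rewrite cyl1; have [i ai] : exists i, onth a (size b) = Some i.
    by case ab: (onth a (size b)) => [i|]; [exists i|have := onthTE a (size b);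
      rewrite ab ba].
  split=> [Fbj|[xb jx]].
    have [y [[yb yj] ya]] := filter_ex (filterI Fbj Fa).
    have yi : entry y (size b) = Some i by rewrite ya.
    split; first by apply/h0; apply: filterS Fbj => ? [].
    by move: yj; rewrite /= (Iset_entry yi) ai.
  apply: filterS (filterI ((h0 b).2 xb) Fa) => y [yb ya].
  have yi : entry y (size b) = Some i by rewrite ya.
  by split=> //=; move: jx; rewrite /= (Iset_entry yi) ai.
- have nb : ~ starts_with b x by move=> /starts_with_defined/(_ ab); rewrite xn.
  rewrite cyl1; split=> [Fb|[//]]; exfalso; apply: nb.
  by apply/h0; apply: filterS Fb => ? [].
- split=> [Fb|xb].
    have xb : starts_with b x by apply/h0; apply: filterS Fb => ? [].
    have eab := starts_with_inj ba xb xa; rewrite eab in Fb *.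
    by rewrite cyl1; split=> //=; rewrite onth_default.
  have eab : b = a := starts_with_inj ba xb.1 xa.
  by case: xb => _; rewrite eab => /(_ j (mem_head _ _)) /=; rewrite onth_default.
Qed.

Lemma ultra_tpath_cvg : exists x, F --> x.
Proof.
have [[a Fa Fai]|h] := pselect (exists2 a, F (starts_with a) & forall i,
  ~ F (starts_with (rcons a i))).
  exact: ultra_finite Fa Fai.
(* [g] extends a word within F. Where no extension exists the word is not in F and any letter will
   do; an empty alphabet is impossible there, since the empty word always belongs to F. *)
have /choice[g Hg] : forall a, exists i, F (starts_with a) -> F (starts_with (rcons a i)).
  move=> a; have [[i Fi]|nF] := pselect (exists i, F (starts_with (rcons a i)));
    first by exists i.
  have nFa : ~ F (starts_with a) by move=> Fa; apply: h; exists a => // i Fi; apply: nF;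
    exists i.
  have [[i0]|nI] := pselect (inhabited I); first by exists i0.
  exfalso; apply: nFa; case: a {nF} => [|i]; last by exfalso; apply: nI.
  by apply: filterS (@filterT _ F _) => x _.
pose w n := iter n (fun a => rcons a (g a)) [::].
apply: (@ultra_infinite (fun n => g (w n)) w) => // n; elim: n => [|n IHn];
  last exact: Hg.
by apply: filterS (@filterT _ F _) => x _.
Qed.

End tpath_compact.

Lemma tpath_compact (I : choiceType) (A : rel I) : compact [set: tpath A].
Proof. by rewrite compact_ultra => F FU _; have [x Fx] := ultra_tpath_cvg FU;
  exists x. Qed.

(** * The topology of the groupoid *)

Lemma cluster_continuous (S T : topologicalType) (f : S -> T) x y :
  continuous f -> cluster (nbhs x) y -> cluster (nbhs (f x)) (f y).
Proof.
move=> cf xy U V /cf fU /cf fV; have [z [Uz Vz]] := xy _ _ fU fV.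
by exists (f z).
Qed.

Lemma gpd_eq (X : Type) (T : X -> option X) (g h : gpd T) :
  rg g = rg h -> deg g = deg h -> sr g = sr h -> g = h.
Proof.
case: g => x k y Hg; case: h => x' k' y' Hh /= xx kk yy; subst.
by rewrite (Prop_irrelevance Hg Hh).
Qed.

Lemma gpd_invK (X : Type) (T : X -> option X) : involutive (@gpd_inv X T).
Proof. by move=> g; apply: gpd_eq; rewrite //= opprK. Qed.

Lemma piter_meetC (X : Type) (T : X -> option X) m n x y :
  piter_meet T m n x y <-> piter_meet T n m y x.
Proof. by split=> -[z [h1 h2]]; exists z. Qed.

Section gpd_topology.
Context (X : topologicalType) (T : X -> option X).

Lemma gpd_subbase : @is_subbase (gpd T) (@gpd_basic_open X T).
Proof. by move=> O; split. Qed.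

Lemma gpd_inv_continuous : continuous (@gpd_inv X T).
Proof.
apply: (subbase_continuous gpd_subbase) => _ [m [n [U [V [oU oV iU iV ->]]]]].
apply: (subbase_open gpd_subbase); exists n, m, V, U; split=> //.
apply/seteqP; split=> g /= [h1 h2 h3 /piter_meetC h4]; split=> //.
  by rewrite -[deg g]opprK h3 opprB.
by rewrite h3 opprB.
Qed.

End gpd_topology.

Section tpath_gpd.
Context (I : choiceType) (A : rel I).
Implicit Types (x y z : tpath A) (a b : seq I) (e : seq I) (i j : I) (n k : nat).
Local Notation T := (@tpath_shift I A).
Local Notation G := (gpd T).
Implicit Types (g h : G).

(* The support of S_a P S_b^*, P being the projection on the set cyl [::] e *)
Definition bis a b e : set G :=
  [set g | [/\ cyl a e (rg g), cyl b e (sr g), deg g = (size a)%:Z - (size b)%:Z &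
               piter_meet T (size a) (size b) (rg g) (sr g)]].

Lemma cyl_piter_inj a e : piter_inj_on T (size a) (cyl a e).
Proof. by move=> x y z [xa _] [ya _]; exact: starts_piter_inj. Qed.

(** The sets U and V are carried along to yield the continuity of [rg] and [sr]. *)
Lemma bis_openI a b e (U V : set (tpath A)) : open U -> open V ->
  open (bis a b e `&` (@rg _ T @^-1` U `&` @sr _ T @^-1` V)).
Proof.
move=> oU oV; apply: (subbase_open (@gpd_subbase _ T)).
exists (size a), (size b), (cyl a e `&` U), (cyl b e `&` V); split.
- by apply: openI => //; case: (cyl_clopen A a e).
- by apply: openI => //; case: (cyl_clopen A b e).
- by move=> x y z [xa _] [ya _]; exact: cyl_piter_inj xa ya.
- by move=> x y z [xa _] [ya _]; exact: cyl_piter_inj xa ya.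
by apply/seteqP; split=> g; [move=> [[h1 h2 h3 h4] [h5 h6]]|move=> [[h1 h2] [h3 h4] h5 h6]].
Qed.

Lemma bis_open a b e : open (bis a b e).
Proof. by have := bis_openI a b e openT openT; rewrite !preimage_setT !setIT. Qed.

Lemma bis_ex g m n : deg g = m%:Z - n%:Z -> piter_meet T m n (rg g) (sr g) ->
  exists a b, [/\ size a = m, size b = n & bis a b [::] g].
Proof.
move=> dg [z [h1 h2]]; have [a am ga] := piter_starts h1; have [b bn gb] :=
  piter_starts h2.
exists a, b; split=> //; split; rewrite ?cyl0 ?am ?bn //; by exists z.
Qed.

Lemma rg_continuous : continuous (@rg _ T : G -> tpath A).
Proof.
apply/continuousP => U oU; rewrite openE => g gU /=.
have [m [n [dg hg]]] := gpdP g; have [a [b [am bn gab]]] := bis_ex dg hg.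
rewrite /interior nbhsE; exists (bis a b [::] `&` (@rg _ T @^-1` U `&` @sr _ T @^-1` setT)).
  by split=> //; exact: bis_openI openT.
by move=> h [_ []].
Qed.

Lemma sr_continuous : continuous (@sr _ T : G -> tpath A).
Proof.
move=> g; have := @continuous_comp _ _ _ (@gpd_inv _ T) (@rg _ T) g.
by apply; [exact: gpd_inv_continuous|exact: rg_continuous].
Qed.

Lemma deg_open (d : int) : open [set g : G | deg g = d].
Proof.
rewrite openE => g /= gd.
have [m [n [dg hg]]] := gpdP g; have [a [b [am bn gab]]] := bis_ex dg hg.
rewrite /interior nbhsE; exists (bis a b [::]); first by split=> //; exact: bis_open.
by move=> h [_ _ hd _]; rewrite /= hd -gd dg am bn.
Qed.

Lemma gpd_hausdorff : hausdorff_space G.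
Proof.
move=> g h gh; apply: gpd_eq.
- by apply: tpath_hausdorff; apply: cluster_continuous gh; exact: rg_continuous.
- have [||k [kg kh]] := gh [set k : G | deg k = deg g] [set k : G | deg k = deg h].
  + by apply: open_nbhs_nbhs; split=> //; exact: deg_open.
  + by apply: open_nbhs_nbhs; split=> //; exact: deg_open.
  + by rewrite -kg kh.
- by apply: tpath_hausdorff; apply: cluster_continuous gh; exact: sr_continuous.
Qed.

(** The range determines the common tail, and the source is b followed by that tail. *)
Lemma bis_rg_inj a b e g h : bis a b e g -> bis a b e h -> rg g = rg h -> g = h.
Proof.
move=> [g1 g2 g3 [z [g4 g5]]] [h1 h2 h3 [w [h4 h5]]] gh; apply: gpd_eq => //;
  first by rewrite g3 h3.
move: h4; rewrite -gh g4 => -[zw]; rewrite -zw in h5.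
exact: cyl_piter_inj g2 h2 g5 h5.
Qed.

Lemma bis_inv a b e g : bis a b e (gpd_inv g) <-> bis b a e g.
Proof.
split=> -[/= h1 h2 h3 /piter_meetC h4]; split=> //=; last by rewrite h3 opprB.
by rewrite -[deg g]opprK h3 opprB.
Qed.

(* Two pairs of exponents witnessing that g lies in the groupoid differ by an
   iterate of the shift, which is injective on paths with a given beginning. *)
Lemma bis_meet_near (F : set_system G) g0 a b m n : Filter F -> bis a b [::] g0 ->
  F (bis a b [::]) -> @rg _ T @ F --> rg g0 -> @sr _ T @ F --> sr g0 ->
  deg g0 = m%:Z - n%:Z -> piter_meet T m n (rg g0) (sr g0) ->
  F [set g | piter_meet T m n (rg g) (sr g)].
Proof.
move=> FF g0ab Fab cr cs d0 hm; have [a' [b' [am bn g0']]] := bis_ex d0 hm.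
have near c x : starts_with c x -> nbhs x (starts_with c : set (tpath A)).
  by move=> xc; apply: open_nbhs_nbhs; split=> //; rewrite -cyl0;
    case: (cyl_clopen A c [::]).
have [[+ _] [+ _] d1 hm1] := g0ab; move=> ga gb.
have [[+ _] [+ _] _ _] := g0'; move=> ga' gb'.
(* If m is at least the length of a, both exponents exceed the lengths of a and b by the same
   amount, and it suffices to shift the common tail further; starting with a' makes this possible
   near g0. *)
have [am'|am'] := leqP (size a) m.
  have nE : n = (size b + (m - size a))%N by lia.
  have Fa' : F [set g | starts_with a' (rg g)] by exact: cr _ (near _ _ ga').
  apply: filterS (filterI Fab Fa') => g [[_ _ _ [z [h1 h2]]] /= ga1].
  have [w gw] := starts_piter ga1; exists w; rewrite -am; split=> //.
  by rewrite nE (piter_add _ h2) -(piter_add _ h1) -gw; congr piter; lia.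
have sE : size a = (m + (size a - m))%N by lia.
have sE' : size b = (n + (size a - m))%N by lia.
(* Now a = a' c and b = b' c for a single word c, since both remainders begin the common value at
   g0. Near g0 the two tails after m and n steps start with c and agree once c is removed, hence are
   equal. *)
pose c := drop m a.
have cE : c = drop n b.
  have [z [h1 h2]] := hm.
  have zc : starts_with c z.
    rewrite -(@starts_with_tl _ _ a' _ (rg g0)) ?am //.
    by rewrite (starts_with_take _ ga' ga) ?am ?cat_take_drop //; lia.
  have zc' : starts_with (drop n b) z.
    rewrite -(@starts_with_tl _ _ b' _ (sr g0)) ?bn //.
    by rewrite (starts_with_take _ gb' gb) ?bn ?cat_take_drop //; lia.
  by apply: starts_with_inj zc zc'; rewrite !size_drop; lia.
have Fa : F [set g | starts_with a (rg g)] by exact: cr _ (near _ _ ga).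
have Fb : F [set g | starts_with b (sr g)] by exact: cs _ (near _ _ gb).
apply: filterS (filterI Fab (filterI Fa Fb)) => g [[_ _ _ [z [h1 h2]]] [/= hga hgb]].
rewrite sE in h1; rewrite sE' in h2.
have [x gx xz] := piter_split h1; have [y gy yz] := piter_split h2.
exists x; split=> //; rewrite gy; congr Some.
have sc : size c = (size a - m)%N by rewrite size_drop.
rewrite -sc in xz yz; apply: starts_piter_inj yz xz.
  rewrite cE -(@starts_with_tl _ _ b' _ (sr g)) ?bn //.
    by rewrite (starts_with_take _ gb' gb) ?bn ?cat_take_drop //; lia.
  rewrite (starts_with_take _ gb' gb) ?bn; last by lia.
  by apply: (@starts_with_catl _ _ _ (drop n b)); rewrite cat_take_drop.
rewrite -(@starts_with_tl _ _ a' _ (rg g)) ?am //.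
  by rewrite (starts_with_take _ ga' ga) ?am ?cat_take_drop //; lia.
rewrite (starts_with_take _ ga' ga) ?am; last by lia.
by apply: (@starts_with_catl _ _ _ (drop m a)); rewrite cat_take_drop.
Qed.

(** Along an ultrafilter the ranges and the sources converge by compactness of the path space; the
    two limits have the same tail, and so form a point of the groupoid. *)
Lemma bis0_compact a b : compact (bis a b [::]).
Proof.
rewrite compact_ultra => F FU Fab.
have FUr : UltraFilter (@rg _ T @ F) by exact: ultra_fmap.
have FUs : UltraFilter (@sr _ T @ F) by exact: ultra_fmap.
have [x Fx] := ultra_tpath_cvg FUr; have [y Fy] := ultra_tpath_cvg FUs.
have lim (H : set_system (tpath A)) u c e : UltraFilter H -> H --> u -> (H (cyl c e) <-> cyl c e u).
  move=> HU Hu; have [oc cc] := cyl_clopen A c e; split=> [Hc|uc].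
    apply: contrapT => uc; have : H (~` cyl c e).
      by apply: Hu; apply: open_nbhs_nbhs; split=> //; rewrite openC.
    by move=> /(filterI Hc); rewrite setICr => /filter_not_empty.
  by apply: Hu; exact: open_nbhs_nbhs.
have xa : cyl a [::] x by apply/(lim _ _ a [::] FUr Fx);
  apply: (@filterS _ F _ _ _ _ Fab) => g [].
have yb : cyl b [::] y by apply/(lim _ _ b [::] FUs Fy);
  apply: (@filterS _ F _ _ _ _ Fab) => g [].
have [xa1 _] := xa; have [yb1 _] := yb.
have [z xz] := starts_piter xa1; have [w yw] := starts_piter yb1.
(* The tails z and w lie in the same cylinders, because F lives on pairs whose tails coincide. *)
have zw : z = w.
  apply: cyl_separated => c e.
  rewrite (cyl_cat _ _ xa1 xz) (cyl_cat _ _ yb1 yw).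
  rewrite -(lim _ _ _ _ FUr Fx) -(lim _ _ _ _ FUs Fy).
  by split=> h; have Fh := [elaborate @filterI _ F _ _ _ h Fab];
  apply: (@filterS _ F _ _ _ _ Fh) => g [/= + [[ga _] [gb _] _ [v [h1 h2]]]];
  rewrite -(cyl_cat _ _ ga h1) -(cyl_cat _ _ gb h2).
have meet : piter_meet T (size a) (size b) x y by exists z; rewrite xz yw zw.
pose g0 : G := Gpd (ex_intro _ (size a) (ex_intro _ (size b) (conj erefl meet))).
have g0ab : bis a b [::] g0 by [].
exists g0; split=> //; apply: (subbase_cvg (@gpd_subbase _ T)).
move=> _ [m [n [U [V [oU oV _ _ ->]]]]] [g0U g0V d0 hm].
have FmU : F (@rg _ T @^-1` U) by apply: Fx; exact: open_nbhs_nbhs.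
have FmV : F (@sr _ T @^-1` V) by apply: Fy; exact: open_nbhs_nbhs.
(* The exponents m and n of a basic open set need not be the lengths of a and b. *)
have Fm := [elaborate bis_meet_near _ g0ab Fab Fx Fy d0 hm].
have Fall := [elaborate filterI (filterI FmU FmV) (filterI Fm Fab)].
apply: (@filterS _ F _ _ _ _ Fall) => g [[gU gV] [gm [_ _ dg _]]].
by split=> //; rewrite dg -d0.
Qed.

Lemma bis_sub0 a b e : bis a b e `<=` bis a b [::].
Proof. by move=> g [[h1 _] [h2 _] h3 h4]; split; rewrite ?cyl0. Qed.

(** The conditions e pass from the range to the source, because both are conditions on the common
    tail. *)
Lemma bis_rgE a b e g : bis a b [::] g -> cyl a e (rg g) -> bis a b e g.
Proof.
move=> [[ga _] [gb _] dg [z [h1 h2]]] gae; split=> //; last by exists z.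
split=> // j /gae.2; have := (piter_entry h1).2 0; have := (piter_entry h2).2 0.
by rewrite !addn0 => <- <-.
Qed.

Lemma bisE a b e : bis a b e = bis a b [::] `&` @rg _ T @^-1` (cyl a e).
Proof.
apply/seteqP; split=> g; last by case; exact: bis_rgE.
by move=> h; split; [exact: bis_sub0 h|case: h].
Qed.

Lemma bis_compact a b e : compact (bis a b e).
Proof.
rewrite bisE; apply: compact_closedI; first exact: bis0_compact.
by move/continuous_closedP: rg_continuous; apply; case: (cyl_clopen A a e).
Qed.

Lemma bis_clopen a b e : clopen (bis a b e).
Proof.
split; first exact: bis_open.
by apply: compact_closed; [exact: gpd_hausdorff|exact: bis_compact].
Qed.

End tpath_gpd.

(** * Functions with compact support and convolution *)

Lemma continuous_indic (S : topologicalType) (K : numFieldType) (W : set S) :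
  clopen W -> continuous (\1_W : S -> K^o).
Proof.
move=> [oW cW]; rewrite -openC in cW.
have loc (V : set S) (r : K^o) c : open V -> V c -> (forall x, V x -> \1_W x = r) ->
    continuous_at c (\1_W : S -> K^o).
  move=> oV Vc Vr; rewrite /continuous_at (Vr _ Vc); apply: cvg_near_cst.
  by have := open_nbhs_nbhs (conj oV Vc); apply: filterS.
move=> c; have [Wc|nWc] := pselect (W c).
  by apply: (loc _ 1 _ oW Wc) => x Wx; rewrite indicE mem_set.
by apply: (loc _ 0 _ cW nWc) => x Wx; rewrite indicE memNset.
Qed.

Lemma lipschitz_continuous (K : numFieldType) (V W : normedModType K) (k : K) (f : V ->
  W) :
  0 <= k -> (forall x y, `|f x - f y| <= k * `|x - y|) -> continuous f.
Proof.
move=> k0 hf x; apply/cvgrPdist_lt => e e0; have k1 : 0 < k + 1 by rewrite ltr_wpDl.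
near=> y; apply: le_lt_trans (hf x y) _.
have : `|x - y| < e / (k + 1) by near: y; apply: cvgr_dist_lt => //; exact: divr_gt0.
rewrite ltr_pdivlMr // mulrC; apply: le_lt_trans.
by rewrite ler_wpM2r // lerDl.
Unshelve. all: by end_near. Qed.

Lemma conjc_continuous (R : realType) : continuous ((fun z => z^*) : R[i]^o -> R[i]^o).
Proof.
by apply: (@lipschitz_continuous _ _ _ 1) => // x y; rewrite mul1r -rmorphB norm_conjC.
Qed.

Section compactly_supported.
Context (R : realType) (X : topologicalType) (T : X -> option X).
Local Notation G := (gpd T).
Hypothesis hG : hausdorff_space G.
Implicit Types (f g : G -> R[i]) (W K : set G).

(** A compact set is closed in a Hausdorff space, so any compact K containing the nonzero points
    contains the closed support. *)
Lemma Cc_intro f K : continuous (f : G -> R[i]^o) -> compact K ->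
  (forall c, f c != 0 -> K c) -> Cc f.
Proof.
move=> cf cK fK; split=> //; apply: (subclosed_compact _ cK); first exact: closed_closure.
by rewrite [X in _ `<=` X]((closure_id _).1 (compact_closed hG cK)); exact: closureS.
Qed.

Lemma Cc_supp f : Cc f -> exists2 K, compact K & forall c, f c != 0 -> K c.
Proof. by case=> _ cK; exists (closure [set c | f c != 0]) => // c fc;
  exact: subset_closure. Qed.

Lemma CcD f g : Cc f -> Cc g -> Cc (fun c => f c + g c).
Proof.
move=> hf hg; have [K cK fK] := Cc_supp hf; have [L cL gL] := Cc_supp hg.
apply: (@Cc_intro _ (K `|` L)); [|exact: compactU|].
  by move=> c; exact: (@cvgD _ R[i]^o _ _ _ f g _ _ (hf.1 c) (hg.1 c)).
move=> c; have [fc|/eqP/fK] := pselect (f c = 0); last by left.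
by rewrite fc add0r => /gL; right.
Qed.

Lemma Cc_indic W : clopen W -> compact W -> Cc (\1_W : G -> R[i]).
Proof.
move=> oW cW; apply: Cc_intro cW _; first exact (@continuous_indic G R[i] W oW).
move=> c; rewrite indicE; have [Wc _|nWc] := pselect (W c); first by [].
by rewrite memNset // eqxx.
Qed.

Lemma CcM f (k : G -> R[i]) : Cc f -> continuous (k : G -> R[i]^o) ->
  Cc (fun c => f c * k c).
Proof.
move=> hf hk; have [K cK fK] := Cc_supp hf; apply: Cc_intro cK _.
  by move=> c; exact: (@cvgM R[i] _ _ _ (f : G -> R[i]^o) (k : G -> R[i]^o) _ _ (hf.1 c) (hk c)).
by move=> c fk; apply: fK; apply: contra_neq fk => ->; rewrite mul0r.
Qed.

Lemma CcZ (r : R[i]) f : Cc f -> Cc (fun c => r * f c).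
Proof.
move=> hf; have -> : (fun c => r * f c) = (fun c => f c * r) by apply/funext => c;
  rewrite mulrC.
exact (CcM hf (@cst_continuous G R[i]^o r)).
Qed.

Lemma Cc0 : Cc (fun _ : G => 0 : R[i]).
Proof.
apply: Cc_intro (@compact0 _) _; first exact (@cst_continuous G R[i]^o 0).
by move=> c; rewrite eqxx.
Qed.

Lemma CcB f g : Cc f -> Cc g -> Cc (fun c => f c - g c).
Proof.
move=> hf hg; have -> : (fun c => f c - g c) = (fun c => f c + -1 * g c).
  by apply/funext => c; rewrite mulN1r.
by apply: CcD => //; exact: CcZ.
Qed.

Lemma Cc_invol f : Cc f -> Cc (invol f).
Proof.
move=> hf; have [K cK fK] := Cc_supp hf.
apply: (@Cc_intro _ (@gpd_inv _ T @` K)).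
- move=> c; apply: (@continuous_comp _ _ _ (f \o @gpd_inv _ T : G -> R[i]^o) _ c);
  last exact: conjc_continuous.
  by apply: continuous_comp; [exact: gpd_inv_continuous|exact: hf.1].
- apply: continuous_compact => //; apply: continuous_subspaceT; exact: gpd_inv_continuous.
- move=> c fc; exists (gpd_inv c); last by rewrite gpd_invK.
  by apply: fK; apply: contra_neq fc => h; rewrite /invol h conjC0.
Qed.

End compactly_supported.

Section convolution.
Context (R : realType) (X : topologicalType) (T : X -> option X).
Local Notation G := (gpd T).
Implicit Types (f g : G -> R[i]) (W V : set G) (a b c : G).

Lemma convol_eq0 f g c : (forall a b, gpd_mul a b c -> f a * g b = 0) -> convol f g c = 0.
Proof. by move=> h; apply: fsbig1 => -[a b] /= /h. Qed.

Lemma gpd_mul_injr a b b' c : gpd_mul a b c -> gpd_mul a b' c -> b = b'.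
Proof.
move=> [h1 h2 h3 h4] [k1 k2 k3 k4]; apply: gpd_eq; rewrite -?h1 -?h3 //.
by move: h4; rewrite k4 => /addrI.
Qed.

(** As [rg] is injective on W, a product c has at most one factorization with left factor in W, and
    the sum reduces to one term. *)
Lemma convol_indicl W f a0 b0 c : set_inj W (@rg _ T) -> W a0 -> gpd_mul a0 b0 c ->
  convol \1_W f c = f b0.
Proof.
move=> injW Wa0 m0; rewrite /convol -(@fsbig_widen _ _ _ _ [set (a0, b0)]) ?fsbig_set1 /=.
- by rewrite indicE mem_set // mul1r.
- by move=> _ ->.
- move=> [a b] /= [m1 ne]; rewrite indicE; have [Wa|nWa] := pselect (W a);
  last by rewrite memNset // mul0r.
  exfalso; apply: ne; have aa : a = a0.
    by apply: injW; rewrite ?inE //; case: m0 => _ <- _ _; case: m1.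
  by rewrite aa in m1 *; rewrite (gpd_mul_injr m1 m0).
Qed.

Lemma convol_indic W V : set_inj W (@rg _ T) ->
  convol \1_W \1_V = \1_[set c | exists a b, [/\ W a, V b & gpd_mul a b c]] :> (G ->
    R[i]).
Proof.
move=> injW; apply/funext => c; rewrite [RHS]indicE.
have [[a [b [Wa Vb m]]]|h] := pselect (exists a b, [/\ W a, V b & gpd_mul a b c]).
  rewrite mem_set; last by exists a, b.
  by rewrite (convol_indicl _ injW Wa m) indicE mem_set.
rewrite memNset //; apply: convol_eq0 => a b m; rewrite !indicE.
have [Wa|nWa] := pselect (W a); last by rewrite memNset // mul0r.
by rewrite [b \in V]memNset ?mulr0 // => Vb; apply: h; exists a, b.
Qed.

Lemma invol_indic W : invol (\1_W : G -> R[i]) = \1_(@gpd_inv _ T @^-1` W).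
Proof.
apply/funext => c; rewrite /invol !indicE; have [Wc|nWc] := pselect (W (gpd_inv c)).
  by rewrite !mem_set // conjC1.
by rewrite !memNset // conjC0.
Qed.

End convolution.

(** * Products of the bisections with the generators and their adjoints *)

Section bis_products.
Context (R : realType) (I : choiceType) (A : rel I).
Implicit Types (x y z : tpath A) (a b : seq I) (e : seq I) (i j k : I).
Local Notation T := (@tpath_shift I A).
Local Notation G := (gpd T).
Implicit Types (c g s : G) (f : G -> R[i]).

Lemma starts_with1 i x : starts_with [:: i] x <-> entry x 0 = Some i.
Proof. by split=> [/(_ 0)->//|xi [|]]. Qed.

Lemma cyl_cons_shift i a e x y : entry x 0 = Some i -> T x = Some y ->
  cyl (i :: a) e x <-> cyl a e y.
Proof. by move=> /starts_with1 xi xy; rewrite -cat1s -(cyl_cat _ _ xi xy). Qed.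

Lemma bis1P i g : bis [:: i] [::] [::] g <->
  [/\ entry (rg g) 0 = Some i, deg g = 1 & T (rg g) = Some (sr g)].
Proof.
rewrite /bis /= !cyl0; split=> [[/starts_with1 h1 _ -> [z [/= h2 [->]]]]|[h1 h2 h3]];
  first by [].
by split=> //; [exact/starts_with1|exists (sr g)].
Qed.

Lemma S_bisectionE i : @S_bisection I A i = bis [:: i] [::] [::].
Proof.
by apply/seteqP; split=> g; [move=> [/starts_with1 h1 h2 h3]; exact/bis1P|
  move=> /bis1P[h1 h2 h3]; split=> //; exact/starts_with1].
Qed.

Lemma set_inj_bis_rg a b e : set_inj (bis a b e) (@rg _ T).
Proof. by move=> g h /[!inE]; exact: bis_rg_inj. Qed.

(** In terms of operators, S_i S_a P S_b^* = S_(ia) P S_b^*. An element (x, k, y) of the right-hand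
    support factors through the shift of x. *)
Lemma convol_cons i a b e :
  convol \1_(bis [:: i] [::] [::]) \1_(bis a b e) = \1_(bis (i :: a) b e) :> (G -> R[i]).
Proof.
rewrite convol_indic; last exact: set_inj_bis_rg.
congr indic; apply/seteqP; split=> c.
  move=> [s [g [/bis1P[si ds ss] [ga gb dg [z [h1 h2]]] [m1 m2 m3 m4]]]].
  split; rewrite ?m2 ?m3 //.
  - by apply/(cyl_cons_shift _ _ si ss); rewrite m1.
  - by rewrite m4 ds dg /=; lia.
  - by exists z; rewrite (piterSr _ ss) m1.
move=> [ca cb dc [z [h1 h2]]].
have ci : entry (rg c) 0 = Some i by rewrite ca.1.
case cx: (T (rg c)) => [x|]; last by have /shift_None := cx; rewrite ci.
have {}h1 : piter T (size a) x = Some z by rewrite -(piterSr _ cx).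
have m1 : piter_meet T (size a) (size b) x (sr c) by exists z.
have m2 : piter_meet T 1 0 (rg c) x by exists x.
pose s : G := Gpd (ex_intro _ _ (ex_intro _ _ (conj erefl m2))).
pose g : G := Gpd (ex_intro _ _ (ex_intro _ _ (conj erefl m1))).
exists s, g; split; first by apply/bis1P; split=> //=.
  by split=> //=; apply/(cyl_cons_shift _ _ ci cx).
by split=> //=; rewrite dc /=; lia.
Qed.

Lemma invol_bis a b e : invol \1_(bis a b e) = \1_(bis b a e) :> (G -> R[i]).
Proof. by rewrite invol_indic; congr indic; apply/seteqP; split=> c /bis_inv. Qed.

(** An element of the support of S_i^* goes from x to i x. The product thus asks for the path y = i
    ([rg c]) to be a terminal path and the range of an element of [bis a b e]. *)
Lemma bis_star_mulP i a b e c :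
  (exists s g, [/\ bis [::] [:: i] [::] s, bis a b e g & gpd_mul s g c]) <->
  exists y, [/\ entry y 0 = Some i, T y = Some (rg c), cyl a e y &
    [/\ cyl b e (sr c), deg c + 1 = (size a)%:Z - (size b)%:Z &
        piter_meet T (size a) (size b) y (sr c)]].
Proof.
split=> [[s [g [/bis_inv/bis1P[/= si ds ss] [ga gb dg hg] [m1 m2 m3 m4]]]]|].
  exists (sr s); rewrite m1 m2 m3 -m1; split=> //; first by rewrite m1.
  by split=> //; [rewrite m4 dg; lia|rewrite m1].
move=> [y [yi yc ya [cb dc hc]]].
have m2 : piter_meet T 0 1 (rg c) y by exists (rg c).
pose s : G := Gpd (ex_intro _ _ (ex_intro _ _ (conj erefl m2))).
pose g : G := Gpd (ex_intro _ _ (ex_intro _ _ (conj erefl hc))).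
exists s, g; split; first by apply/bis_inv/bis1P; split.
  by [].
by split=> //=; rewrite -dc; lia.
Qed.

(** This is S_i^* S_(ia) P S_b^* = Q_i S_a P S_b^*, where Q_i = S_i^* S_i projects on the paths that
    i may precede. *)
Lemma bis_star_cons i a b e c :
  (exists s g, [/\ bis [::] [:: i] [::] s, bis (i :: a) b e g & gpd_mul s g c]) <->
  Iset 0 (rg c) i /\ bis a b e c.
Proof.
rewrite bis_star_mulP; split=> [[y [yi yc ya [cb dc [z [h1 h2]]]]]|[ci [ca cb dc [z [h1 h2]]]]].
  split; first by rewrite (shift_entry yc).2; exact: Iset_last.
  split=> //; [by apply/(cyl_cons_shift _ _ yi yc)|by move: dc => /=; lia|].
  by exists z; rewrite -(piterSr _ yc).
have [y [yi yc]] := tcons_ex ci; exists y; split=> //.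
  exact/(cyl_cons_shift _ _ yi yc).
by split=> //; [rewrite dc /=; lia|exists z; rewrite (piterSr _ yc)].
Qed.

(** The projection P with conditions e satisfies P S_i = S_i if every j in e may precede i, and P
    S_i = 0 otherwise. Taking adjoints, S_i^* P S_b^* is the adjoint of S_b S_i, or zero. *)
Lemma bis_star_nil i b e c :
  (exists s g, [/\ bis [::] [:: i] [::] s, bis [::] b e g & gpd_mul s g c]) <->
  (forall j, j \in e -> A j i) /\ bis [::] (rcons b i) [::] c.
Proof.
rewrite bis_star_mulP; split=> [[y [yi yc [_ ye] [[cb _] dc [z [[yz] h2]]]]]|].
  rewrite -yz in h2; split.
    by move=> j /ye; rewrite (Iset_entry yi).
  split; rewrite ?cyl0 //.
  - by apply/starts_with_rcons; split=> //; rewrite -[size b]addn0 -(piter_entry h2).1.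
  - by rewrite size_rcons /= in dc *; lia.
  - by exists (rg c); rewrite size_rcons piterS h2.
move=> [ej [_ [/starts_with_rcons[cb cy] _] dc [z [[cz] h2]]]].
rewrite -cz size_rcons -addn1 in h2; have [y cy' yc] := piter_split h2.
have yi : entry y 0 = Some i by rewrite (piter_entry cy').1 addn0.
exists y; split=> //; first by split=> // j /ej; rewrite (Iset_entry yi).
split; last by exists y.
  by split=> // j /ej; rewrite (Iset_entry cy).
by rewrite dc size_rcons /=; lia.
Qed.

Lemma bis_Iset i b e c : (Iset 0 (rg c) i /\ bis [::] b e c) <-> bis [::] b (i :: e) c.
Proof.
rewrite [bis _ _ e]bisE [bis _ _ (i :: e)]bisE cyl_cons cyl1 /=.
by split=> [[h1 [h2 [_ h3]]]|[h2 [[_ h1] [_ h3]]]].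
Qed.

(** If a is empty, the letter i moves to the end of b or the product vanishes. If a starts with
    another letter, the product vanishes. If a = i, the condition i joins e. If a = i k ..., then
    Q_i S_k is S_k or zero according to [A i k]. No case produces the unit. *)
Lemma convol_star i a b e : (a, b, e) <> ([::], [::], [::]) ->
  exists2 V, V = set0 \/ (exists a' b' e', (a', b', e') <> ([::], [::], [::]) /\
    V = bis a' b' e') &
    convol \1_(bis [::] [:: i] [::]) \1_(bis a b e) = \1_V :> (G -> R[i]).
Proof.
move=> tau; rewrite convol_indic; last exact: set_inj_bis_rg.
set V := [set c | _]; exists V => //; case: a tau @V => [|i0 a] tau V.
  have [ej|nej] := pselect (forall j, j \in e -> A j i).
    right; exists [::], (rcons b i), [::]; split; first by case: (b).
    by apply/seteqP; split=> c; [move=> /bis_star_nil[]|move=> h; apply/bis_star_nil].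
  by left; apply/seteqP; split=> // c /bis_star_nil[].
have [ii|nii] := eqVneq i0 i; last first.
  left; apply/seteqP; split=> // c /bis_star_mulP[y [yi _ [+ _] _]].
  by move=> /(_ 0 isT); rewrite yi => -[/eqP]; rewrite eq_sym (negbTE nii).
rewrite /V ii; case: a tau V => [|k a] tau V.
  right; exists [::], b, (i :: e); split=> //.
  by apply/seteqP; split=> c; [move=> /bis_star_cons/bis_Iset|move=> /bis_Iset/bis_star_cons].
have colk c : bis (k :: a) b e c -> Iset 0 (rg c) = column A k.
  by move=> [[+ _] _ _ _] => /(_ 0 isT) /Iset_entry.
case ik : (A i k).
  right; exists (k :: a), b, e; split=> //; apply/seteqP; split=> c;
    first by move=> /bis_star_cons[].
  by move=> h; apply/bis_star_cons; split=> //; rewrite (colk _ h).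
left; apply/seteqP; split=> // c /bis_star_cons[+ /colk h].
by rewrite h /column /= ik.
Qed.

Lemma convol_star1 i e :
  convol \1_(bis [::] [:: i] [::]) \1_(bis [:: i] [::] e) = \1_(bis [::] [::] (i :: e)) :> (G -> R[i]).
Proof.
rewrite convol_indic; last exact: set_inj_bis_rg.
congr indic; apply/seteqP.
by split=> c; [move=> /bis_star_cons/bis_Iset|move=> /bis_Iset/bis_star_cons].
Qed.

(** S_a P S_a^* is supported on units, so multiplying by it on the left cuts f down to the elements
    with range in a cylinder. *)
Lemma convol_diag a e f :
  convol \1_(bis a a e) f = fun c => f c * \1_(cyl a e) (rg c).
Proof.
apply/funext => c; have [ca|nca] := pselect (cyl a e (rg c)).
  have m0 : piter_meet T 0 0 (rg c) (rg c) by exists (rg c).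
  (* The unit at the range of c is the only possible left factor. *)
  pose u : G := Gpd (ex_intro _ _ (ex_intro _ _ (conj erefl m0))).
  rewrite (@convol_indicl _ _ _ _ _ u c c); first by rewrite indicE mem_set ?mulr1.
  - exact: set_inj_bis_rg.
  - split=> //=; first by rewrite !subrr.
    by have [z hz] := starts_piter ca.1; exists z.
  - by split=> //=; rewrite subrr add0r.
rewrite [\1__ _]indicE memNset // mulr0; apply: convol_eq0 => s g [_ cs _ _].
by rewrite indicE memNset ?mul0r // => -[+ _ _ _]; rewrite -cs.
Qed.

End bis_products.

(** * Subspaces of C*-algebras *)

Section cstar_algebra.
Context (R : realType) (B : cstarAlgebraType R).
Implicit Types (x y z : B) (M S : set B).

Lemma cmulBl x y z : cmul (x - y) z = cmul x z - cmul y z :> B.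
Proof. by rewrite cmulDl -scaleN1r cmulZl scaleN1r. Qed.

Lemma cmulBr x y z : cmul x (y - z) = cmul x y - cmul x z :> B.
Proof. by rewrite cmulDr -scaleN1r cmulZr scaleN1r. Qed.

Lemma cstarB x y : cstar (x - y) = cstar x - cstar y :> B.
Proof. by rewrite cstarD -scaleN1r cstarZ rmorphN1 scaleN1r. Qed.

Lemma norm_cstar_le x : `|x| <= `|cstar x : B|.
Proof.
have [->|x0] := eqVneq x 0; first by rewrite normr0.
have : `|x| ^+ 2 <= `|cstar x : B| * `|x| by rewrite -norm_cstar_cmul norm_cmul.
by rewrite expr2 ler_pM2r // normr_gt0.
Qed.

Lemma norm_cstar x : `|cstar x : B| = `|x|.
Proof. by apply/eqP; rewrite eq_le -{2}(cstarK x) !norm_cstar_le. Qed.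

Lemma cmul_continuousr x : continuous (fun y : B => cmul x y : B).
Proof.
apply: (@lipschitz_continuous _ _ _ `|x|) => // y z.
by rewrite -cmulBr norm_cmul.
Qed.

Lemma cmul_continuousl y : continuous (fun x : B => cmul x y : B).
Proof.
apply: (@lipschitz_continuous _ _ _ `|y|) => // x z.
by rewrite -cmulBl mulrC norm_cmul.
Qed.

Lemma cstar_continuous : continuous (fun x : B => cstar x : B).
Proof.
apply: (@lipschitz_continuous _ _ _ 1) => // x y.
by rewrite mul1r -cstarB norm_cstar.
Qed.

Record closed_subspace M : Prop := {
  clss_closed : closed M;
  clss0 : M 0;
  clssD : forall x y, M x -> M y -> M (x + y);
  clssZ : forall (r : R[i]) x, M x -> M (r *: x)
}.

Lemma clssB M x y : closed_subspace M -> M x -> M y -> M (x - y).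
Proof. by move=> hM Mx My; rewrite -scaleN1r; apply: clssD => //; exact: clssZ. Qed.

Lemma closed_subspace_approx M x : closed_subspace M ->
  (forall d : R[i], 0 < d -> exists2 y, M y & `|x - y| <= d) -> M x.
Proof.
move=> hM h; apply: (clss_closed hM) => U /nbhs_ballP[d /= d0 dU].
have [y My xy] := h (d / 2) (divr_gt0 d0 (ltr0Sn _ 1)).
exists y; split=> //; apply: dU; rewrite -ball_normE /=.
by apply: le_lt_trans xy _; rewrite ltr_pdivrMr // ltr_pMr // ltr1n.
Qed.

Lemma sub_cstar_closed_subspace M : sub_cstar_algebra M -> closed_subspace M.
Proof. by case. Qed.

Lemma smallest_closed_subspace S : closed_subspace (smallest closed_subspace S).
Proof.
split.
- by apply: closed_bigI => M [[]].
- by move=> M [[]].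
- by move=> x y Sx Sy M [hM SM]; apply: (clssD hM); [exact: Sx|exact: Sy].
- by move=> r x Sx M [hM SM]; apply: (clssZ hM); exact: Sx.
Qed.

Lemma generated_cstarP S : sub_cstar_algebra (generated_cstar S).
Proof.
split.
- by apply: closed_bigI => M [[]].
- by move=> M [[]].
- by move=> x y Sx Sy M [hM SM]; apply: (subcsD hM); [exact: Sx|exact: Sy].
- by move=> r x Sx M [hM SM]; apply: (subcsZ hM); exact: Sx.
- by move=> x y Sx Sy M [hM SM]; apply: (subcsM hM); [exact: Sx|exact: Sy].
- by move=> x Sx M [hM SM]; apply: (subcsV hM); exact: Sx.
Qed.

(** The scalar r' may differ from r so that the adjoint, which is conjugate-linear, is covered. *)
Lemma closed_subspace_preimage M (f : B -> B) : closed_subspace M -> continuous f ->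
  (forall x y, f (x + y) = f x + f y) ->
  (forall (r : R[i]) x, exists r' : R[i], f (r *: x) = r' *: f x) ->
  closed_subspace [set x | M (f x)].
Proof.
move=> hM cf fD fZ; split=> /=.
- by move/continuous_closedP: cf; apply; exact: clss_closed hM.
- have -> : f 0 = 0 by apply: (@addrI _ (f 0)); rewrite -fD !addr0.
  exact: clss0.
- by move=> x y Mx My; rewrite fD; exact: clssD.
- by move=> r x Mx; have [r' ->] := fZ r x; exact: clssZ.
Qed.

(* The elements b of M with b M and b^* M inside M form a C*-algebra. *)
Lemma generated_cstar_sub M S : closed_subspace M -> S `<=` M ->
  (forall s x, S s -> M x -> M (cmul s x)) ->
  (forall s x, S s -> M x -> M (cmul (cstar s) x)) ->
  (forall x, M x -> M (cstar x)) ->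
  generated_cstar S `<=` M.
Proof.
move=> hM SM SMM SVM MV.
pose N := [set x | M x] `&` (\bigcap_(y in M) [set x | M (cmul x y)]) `&`
  (\bigcap_(y in M) [set x | M (cmul (cstar x) y)]).
suff : generated_cstar S `<=` N by move=> h x /h[[]].
have N1 y : closed_subspace [set x : B | M (cmul x y)].
  apply: closed_subspace_preimage => //; first exact: cmul_continuousl.
    by move=> x z; rewrite cmulDl.
  by move=> r x; exists r; rewrite cmulZl.
have N2 y : closed_subspace [set x : B | M (cmul (cstar x) y)].
  apply: (@closed_subspace_preimage M (fun x => cmul (cstar x) y)) => //.
  - move=> x; apply: (@continuous_comp _ _ _ (fun x : B => cstar x : B) (fun x : B => cmul x y : B)).
      exact: cstar_continuous.
    exact: cmul_continuousl.
  - by move=> x z; rewrite cstarD cmulDl.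
  - by move=> r x; exists r^*; rewrite cstarZ cmulZl.
apply: smallest_sub; last first.
  by move=> s Ss; split; [split; [exact: SM|move=> y My; exact: SMM]|move=> y My;
    exact: SVM].
split.
- apply: closedI; [apply: closedI|]; first exact: clss_closed hM.
    by apply: closed_bigI => y My; exact: clss_closed (N1 y).
  by apply: closed_bigI => y My; exact: clss_closed (N2 y).
- by split; [split; [exact: clss0 hM|move=> y _; exact: clss0 (N1 y)]|move=> y _;
  exact: clss0 (N2 y)].
- move=> x z [[Mx x1] x2] [[Mz z1] z2]; split; [split;
  [exact: clssD hM _ _ Mx Mz|]|] => y My.
    by apply: (clssD (N1 y)); [exact: x1|exact: z1].
  by apply: (clssD (N2 y)); [exact: x2|exact: z2].
- move=> r x [[Mx x1] x2]; split; [split; [exact: clssZ hM _ _ Mx|]|] => y My.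
    by apply: (clssZ (N1 y)); exact: x1.
  by apply: (clssZ (N2 y)); exact: x2.
- move=> x z [[Mx x1] x2] [[Mz z1] z2]; split; [split; [exact: x1|]|] => y My /=.
    by rewrite -cmulA; apply: x1; exact: z1.
  by rewrite cstarM -cmulA; apply: z2; exact: x2.
- move=> x [[Mx x1] x2]; split; [split; [exact: MV|exact: x2]|] => y My /=.
  by rewrite cstarK; exact: x1.
Qed.

End cstar_algebra.

(** * The algebra O_A as a closed span of bisections *)

Section cuntz_krieger_span.
Context (R : realType) (I : choiceType) (A : rel I).
Implicit Types (x y z : tpath A) (a b : seq I) (e : seq I) (i j k : I).
Local Notation T := (@tpath_shift I A).
Local Notation G := (gpd T).
Context (B : cstarAlgebraType R) (iota : (G -> R[i]) -> B).
Hypothesis hi : star_repr iota.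

Lemma Cc_bis a b e : Cc (\1_(bis a b e) : G -> R[i]).
Proof.
by apply: Cc_indic; [exact: gpd_hausdorff|exact: bis_clopen|exact: bis_compact].
Qed.

Lemma iota_set0 : iota \1_set0 = 0.
Proof.
have := @star_reprZ _ _ _ _ _ hi 0 _ (Cc_bis [::] [::] [::]); rewrite scale0r => <-.
by congr iota; apply/funext => c; rewrite indic0 mul0r.
Qed.

Lemma iotaV_bis a b e : cstar (iota \1_(bis a b e)) = iota \1_(bis b a e).
Proof. by rewrite -(star_reprV hi) ?invol_bis //; exact: Cc_bis. Qed.

Definition span_bis : set B := smallest (@closed_subspace R B)
  [set u | exists a b e, (a, b, e) <> ([::], [::], [::]) /\ u = iota \1_(bis a b e)].

Lemma span_bisP : closed_subspace span_bis.
Proof. exact: smallest_closed_subspace. Qed.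

Lemma span_bis_bis a b e : (a, b, e) <> ([::], [::], [::]) ->
  span_bis (iota \1_(bis a b e)).
Proof. by move=> tau; apply: sub_gen_smallest; exists a, b, e. Qed.

Lemma span_bis_sub (M : set B) : closed_subspace M ->
  (forall a b e, (a, b, e) <> ([::], [::], [::]) -> M (iota \1_(bis a b e))) ->
    span_bis `<=` M.
Proof. by move=> hM h; apply: smallest_sub => // u [a [b [e [tau ->]]]]; exact: h. Qed.

Lemma cstar_span_bis : span_bis `<=` [set u | span_bis (cstar u)].
Proof.
apply: span_bis_sub => [|a b e tau] /=.
  apply: closed_subspace_preimage;
    [exact: span_bisP|exact: cstar_continuous|exact: cstarD|].
  by move=> r u; exists r^*; rewrite cstarZ.
by rewrite iotaV_bis; apply: span_bis_bis => -[b0 a0 e0]; apply: tau; rewrite b0 a0 e0.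
Qed.

Lemma mul_span_bis u : (forall a b e, (a, b, e) <> ([::], [::], [::]) ->
  span_bis (cmul u (iota \1_(bis a b e)))) -> span_bis `<=` [set v | span_bis (cmul u v)].
Proof.
move=> h; apply: span_bis_sub => // /=.
apply: closed_subspace_preimage; [exact: span_bisP|exact: cmul_continuousr| |].
  by move=> v w; rewrite cmulDr.
by move=> r v; exists r; rewrite cmulZr.
Qed.

Lemma OA_sub_span : OA iota `<=` span_bis.
Proof.
apply: generated_cstar_sub.
- exact: span_bisP.
- by move=> _ [i _ <-]; rewrite S_bisectionE; exact: span_bis_bis.
- move=> _ u [i _ <-]; rewrite S_bisectionE; apply: mul_span_bis => a b e tau.
  rewrite -(star_reprM hi); [|exact: Cc_bis|exact: Cc_bis].
  by rewrite convol_cons; exact: span_bis_bis.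
- move=> _ u [i _ <-]; rewrite S_bisectionE; apply: mul_span_bis => a b e tau.
  rewrite iotaV_bis -(star_reprM hi); [|exact: Cc_bis|exact: Cc_bis].
  have [V [->|[a' [b' [e' [tau' ->]]]]] ->] := @convol_star R I A i a b e tau.
    by rewrite iota_set0; exact: clss0 span_bisP.
  exact: span_bis_bis.
- exact: cstar_span_bis.
Qed.

Lemma OA_sub_cstar : sub_cstar_algebra (OA iota).
Proof. exact: generated_cstarP. Qed.

(** Projections come from S_i^* S_i P, a word on the left from multiplication by the S_k, and a word
    on the right from adjoints. *)
Lemma OA_bis a b e : (a, b, e) <> ([::], [::], [::]) -> OA iota (iota \1_(bis a b e)).
Proof.
have hS i : OA iota (iota \1_(bis [:: i] [::] [::])).
  by apply: sub_gen_smallest; exists i => //; rewrite S_bisectionE.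
have hcons i a' b' e' : OA iota (iota \1_(bis a' b' e')) -> OA iota (iota \1_(bis (i :: a') b' e')).
  move=> h; rewrite -convol_cons (star_reprM hi); [|exact: Cc_bis|exact: Cc_bis].
  exact: (subcsM OA_sub_cstar).
have hV a' b' e' : OA iota (iota \1_(bis a' b' e')) -> OA iota (iota \1_(bis b' a' e')).
  by move=> h; rewrite -iotaV_bis; exact: (subcsV OA_sub_cstar).
have hD i e' : OA iota (iota \1_(bis [::] [::] (i :: e'))).
  elim: e' i => [|j e' IH] i; rewrite -convol_star1 (star_reprM hi); try exact: Cc_bis.
    by apply: (subcsM OA_sub_cstar); [apply: hV; exact: hS|exact: hS].
  by apply: (subcsM OA_sub_cstar); [apply: hV; exact: hS|apply: hcons; exact: IH].
have hl a' e' : a' <> [::] \/ e' <> [::] -> OA iota (iota \1_(bis a' [::] e')).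
  case: e' => [|i e'] h; last by elim: a' {h} => // k a' IH; exact: hcons.
  case: h => // ; elim: a' => // k [|k' a'] IH _; first exact: hS.
  by apply: hcons; exact: IH.
(* For b and e both empty, an induction on a down to the empty word would end in the unit; it has to
   stop at a single letter, as in [hl]. Otherwise the base case is the adjoint of an element given
   by [hl]. *)
move=> tau; have [abe|abe] := pselect (b = [::] /\ e = [::]).
  by move: tau; rewrite abe.1 abe.2 => tau; apply: hl; left => a0; apply: tau; rewrite a0.
elim: a {tau} => [|k a IH]; last exact: hcons.
apply: hV; apply: hl; have [b0|] := pselect (b = [::]); last by left.
by right => e0; apply: abe.
Qed.

End cuntz_krieger_span.

(** * The norm of a function supported in a bisection *)

(** If no finite list covers K, the complements in K of the finite unions generate a proper filter;
    a cluster point of it in K lies in some [f j], although K minus [f j] belongs to the filter. *)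
Lemma compact_seq_cover (S : topologicalType) (J : eqType) (D : set J) (f : J ->
  set S) (K : set S) :
  compact K -> (forall j, D j -> open (f j)) -> (forall x, K x -> exists2 j, D j &
    f j x) ->
  exists2 s : seq J, (forall j, j \in s -> D j) & forall x, K x -> exists2 j, j \in s &
    f j x.
Proof.
move=> cK fo fK; apply: contrapT => h.
pose U (s : seq J) := [set x | exists2 j, j \in s & f j x].
pose F := filter_from [set s : seq J | forall j, j \in s -> D j] (fun s => K `\` U s).
have FF : ProperFilter F.
  apply: filter_from_proper => [|s Ds].
    apply: filter_from_filter; first by exists [::].
    move=> s t Ds Dt; exists (s ++ t) => [j|x [Kx nx]].
      by rewrite mem_cat => /orP[/Ds|/Dt].
    split; split=> // -[j js fj]; apply: nx; exists j => //; rewrite mem_cat js ?orbT //.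
  apply: contrapT => n0; apply: h; exists s => // x Kx.
  by apply: contrapT => nx; apply: n0; exists x.
have FK : F K by exists [::] => // x [].
have [x [Kx clx]] := cK F FF FK; have [j Dj fj] := fK _ Kx.
have [||y [[Ky ny] fy]] := clx (K `\` U [:: j]) (f j).
- by exists [:: j] => // k; rewrite inE => /eqP ->.
- by apply: open_nbhs_nbhs; split=> //; exact: fo.
- by apply: ny; exists j => //; rewrite inE.
Qed.

Lemma half_sqr_le (R : realFieldType) (a b d : R) :
  `|a| <= d / 2 -> `|b| <= d / 2 -> a ^+ 2 + b ^+ 2 <= d ^+ 2.
Proof. by rewrite !ler_norml => /andP[a1 a2] /andP[b1 b2]; nra. Qed.

Section unit_circle.
Context (R : realType).
Local Open Scope complex_scope.
Implicit Types (z : R[i]).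

Lemma norm_complexP z (d : R) : 0 <= d ->
  (`|z| <= d%:C) = ((complex.Re z) ^+ 2 + (complex.Im z) ^+ 2 <= d ^+ 2).
Proof.
move=> d0; rewrite normc_def lecR -[X in _ <= X](ger0_norm d0) -[X in _ <= X]sqrtr_sqr.
by rewrite ler_sqrt // exprn_ge0.
Qed.

Lemma complex_continuous (S : topologicalType) (p q : S -> R) :
  continuous p -> continuous q -> continuous ((fun x => p x +i* q x) : S -> R[i]^o).
Proof.
move=> cp cq x; apply/cvgrPdist_le => e e0.
have [d de] : exists d : R, e = d%:C by exists (complex.Re e);
  rewrite RRe_real // gtr0_real.
rewrite de ltcR in e0 *.
near=> y.
rewrite (norm_complexP _ (ltW e0)) /=.
have hp : `|p x - p y| <= d / 2 by near: y; move/cvgrPdist_le: (cp x); apply;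
  exact: divr_gt0.
have hq : `|q x - q y| <= d / 2 by near: y; move/cvgrPdist_le: (cq x); apply;
  exact: divr_gt0.
exact: half_sqr_le hp hq.
Unshelve. all: by end_near. Qed.

Lemma real_lipschitz_continuous (V : normedModType R[i]) (f : V -> R) :
  (forall x y, `|f x - f y|%:C <= `|x - y|) -> continuous f.
Proof.
move=> hf x; apply/cvgrPdist_lt => e e0; near=> y.
rewrite -ltcR; apply: le_lt_trans (hf x y) _.
by near: y; apply: cvgr_dist_lt => //; rewrite ltcR.
Unshelve. all: by end_near. Qed.

Lemma Re_continuous : continuous (@complex.Re R : R[i]^o -> R^o).
Proof.
apply: real_lipschitz_continuous => x y; apply: le_trans (normc_ge_Re _).
by case: x y => [? ?] [? ?].
Qed.

(* Of modulus one when |Re z| <= 1 and s = 1 or s = -1 *)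
Definition circle (s : R) z : R[i] :=
  complex.Re z +i* (s * Num.sqrt (1 - complex.Re z ^+ 2)).

Lemma circle_continuous s : continuous (circle s : R[i]^o -> R[i]^o).
Proof.
have cg : continuous (fun x : R => s * Num.sqrt (1 - x ^+ 2)).
  move=> x; apply: (@cvgM R _ _ _ (fun _ => s)); first exact: cvg_cst.
  apply: (@continuous_comp _ _ _ (fun x : R => 1 - x ^+ 2) (@Num.sqrt R));
    last exact: sqrt_continuous.
  by apply: cvgB; [exact: cvg_cst|exact: exprn_continuous].
apply: complex_continuous; first exact: Re_continuous.
move=> z; apply: (@continuous_comp R[i]^o R R (@complex.Re R) (fun x : R => s * Num.sqrt (1 - x ^+ 2))).
  exact: Re_continuous.
exact: cg.
Qed.

Lemma norm_circle s z : s ^+ 2 = 1 -> `|z| <= 1 -> `|circle s z| = 1.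
Proof.
move=> s1 z1; have z2 : complex.Re z ^+ 2 <= 1.
  have : (`|z| <= 1%:C) by [].
  by rewrite norm_complexP //; have := sqr_ge0 (complex.Im z); lra.
rewrite normc_def /= exprMn s1 mul1r sqr_sqrtr; last by lra.
by rewrite addrC subrK sqrtr1.
Qed.

(** The square roots cancel between s = 1 and s = -1. There remains Re z + i Re(-iz), and Re(-iz) =
    Im z. *)
Lemma circle_decomp z :
  z = 2^-1 * (circle 1 z + circle (-1) z + 'i * circle 1 (- 'i * z) + 'i * circle (-1) (- 'i * z)).
Proof.
case: z => x y; rewrite /circle /=.
apply/eqP; rewrite eq_complex /=; apply/andP.
by split; apply/eqP; field.
Qed.

End unit_circle.

Section bisection_norm.
Context (R : realType) (I : choiceType) (A : rel I).
Implicit Types (x y z : tpath A) (a b : seq I) (e : seq I) (i j : I).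
Local Notation T := (@tpath_shift I A).
Local Notation G := (gpd T).
Context (B : cstarAlgebraType R) (iota : (G -> R[i]) -> B).
Hypothesis hi : star_repr iota.
Implicit Types (f u : G -> R[i]) (c : G).

Lemma iotaB f u : Cc f -> Cc u -> iota (fun c => f c - u c) = iota f - iota u.
Proof.
move=> hf hu; have -> : (fun c => f c - u c) = (fun c => f c + -1 * u c).
  by apply/funext => c; rewrite mulN1r.
rewrite (star_reprD hi) // ?(star_reprZ hi) ?scaleN1r //.
exact: CcZ (@gpd_hausdorff _ A) _ _ hu.
Qed.

(** By the C*-identity it is enough that u^* u and 1_W^* 1_W agree as convolutions. *)
Lemma norm_iota_unimodular a b e u : Cc u -> (forall c, ~ bis a b e c -> u c = 0) ->
  (forall c, bis a b e c -> `|u c| = 1) -> `|iota u| = `|iota \1_(bis a b e)|.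
Proof.
move=> hu u0 u1; apply/eqP; rewrite -(@eqrXn2 _ 2) // -!norm_cstar_cmul.
have hG := @gpd_hausdorff _ A; have h1 := @Cc_bis R _ A a b e.
rewrite -!(star_reprV hi) // -!(star_reprM hi) //; try exact: Cc_invol.
suff -> : convol (invol u) u = convol (invol \1_(bis a b e)) \1_(bis a b e) by [].
apply/funext => c; apply: eq_fsbigr => -[g h] /[!inE] /= -[gh _ _ _].
rewrite /invol !indicE; have [hb|nhb] := pselect (bis a b e h); last first.
  by rewrite (u0 h) // [h \in _]memNset // !mulr0.
have [gb|ngb] := pselect (bis a b e (gpd_inv g)); last first.
  by rewrite (u0 (gpd_inv g)) // [gpd_inv g \in _]memNset // conjC0 !mul0r.
(* Both elements of the bisection have the same range, so the term is the square of the modulus of u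
   at h. *)
have -> : gpd_inv g = h by exact: bis_rg_inj gb hb gh.
by rewrite mem_set // conjC1 mul1r mulrC -normCK u1 // expr1n.
Qed.

(** The constant 2 is half of four: by [circle_decomp], f is half a combination, with coefficients
    of modulus one, of four functions having the norm of the indicator. *)
Lemma norm_iota_le1 a b e f : Cc f -> (forall c, ~ bis a b e c -> f c = 0) ->
  (forall c, `|f c| <= 1) -> `|iota f| <= 2 * `|iota \1_(bis a b e)|.
Proof.
move=> hf f0 f1; have hG := @gpd_hausdorff _ A.
set C := `|iota \1_(bis a b e)|.
(* The factor [\1_(bis a b e)] restores the support, as [circle s 0] is not zero. *)
pose u (s : R) (k : R[i]) c := \1_(bis a b e) c * circle s (k * f c).
have cu s k : Cc (u s k).
  apply: CcM => //; first exact: Cc_bis.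
  move=> c; exact (@continuous_comp G R[i]^o R[i]^o _ (circle s) c
    ((CcZ hG k hf).1 c) (@circle_continuous R s (k * f c))).
have nu s k : s ^+ 2 = 1 -> `|k| = 1 -> `|iota (u s k)| = C.
  move=> s1 k1; apply: norm_iota_unimodular => // c hc; rewrite /u indicE.
    by rewrite memNset // mul0r.
  by rewrite mem_set // mul1r norm_circle // normrM k1 mul1r.
have fE : f = fun c => 2^-1 * ((u 1 1 c + u (-1) 1 c) + 'i%C * (u 1 (- 'i%C) c + u (-1) (- 'i%C) c)).
  apply/funext => c; rewrite /u indicE; have [hc|nhc] := pselect (bis a b e c).
    by rewrite mem_set // !mul1r {1}[f c]circle_decomp; congr (_ * _);
      rewrite mulrDr addrA.
  by rewrite memNset // !mul0r !addr0 !mulr0 f0 // addr0 mulr0.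
have i1 : `|'i%C : R[i]| = 1 by rewrite normc_def /= expr0n expr1n add0r sqrtr1.
have s1 : (1 : R) ^+ 2 = 1 by rewrite expr1n.
have sN1 : (-1 : R) ^+ 2 = 1 by rewrite sqrrN expr1n.
have ni1 : `|- 'i%C : R[i]| = 1 by rewrite normrN.
rewrite {1}fE (star_reprZ hi); last by do ?apply: CcD => //; apply: CcZ => //; apply: CcD.
rewrite (star_reprD hi); [|exact: CcD|by apply: CcZ => //; exact: CcD].
rewrite (star_reprZ hi); last exact: CcD.
rewrite !(star_reprD hi) // normrZ normfV normr_nat ler_pdivrMl //.
apply: le_trans (ler_normD _ _) _; rewrite normrZ i1 mul1r.
have -> : 2 * (2 * C) = (C + C) + (C + C) by ring.
by apply: lerD; apply: le_trans (ler_normD _ _) _; rewrite !nu // normr1.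
Qed.

Lemma norm_iota_le a b e f (d : R[i]) : 0 < d -> Cc f -> (forall c, ~ bis a b e c ->
  f c = 0) ->
  (forall c, `|f c| <= d) -> `|iota f| <= d * (2 * `|iota \1_(bis a b e)|).
Proof.
move=> d0 hf f0 fd; have hG := @gpd_hausdorff _ A.
have -> : f = fun c => d * (d^-1 * f c) by apply/funext => c; rewrite mulVKf // gt_eqF.
have hdf : Cc (fun c => d^-1 * f c) by exact: CcZ.
rewrite (star_reprZ hi) // normrZ gtr0_norm // ler_pM2l //.
apply: norm_iota_le1 => // c; first by move=> /f0 ->; rewrite mulr0.
by rewrite normrM normfV (gtr0_norm d0) mulrC ler_pdivrMr // mul1r.
Qed.

End bisection_norm.

(** * Density *)

Section density.
Context (R : realType) (I : choiceType) (A : rel I).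
Implicit Types (x y z : tpath A) (a b : seq I) (e : seq I) (i j : I).
Local Notation T := (@tpath_shift I A).
Local Notation G := (gpd T).
Context (B : cstarAlgebraType R) (iota : (G -> R[i]) -> B).
Hypothesis hi : star_repr iota.
Implicit Types (f u : G -> R[i]) (c g : G) (C : set (tpath A)).

Let hG : hausdorff_space G := @gpd_hausdorff _ A.

Let OA_subspace : closed_subspace (OA iota) :=
  sub_cstar_closed_subspace (OA_sub_cstar iota).

Definition restrict f C : G -> R[i] := fun c => f c * \1_C (rg c).

Lemma restrictT f C c : C (rg c) -> restrict f C c = f c.
Proof. by move=> h; rewrite /restrict indicE mem_set // mulr1. Qed.

Lemma restrictF f C c : ~ C (rg c) -> restrict f C c = 0.
Proof. by move=> h; rewrite /restrict indicE memNset // mulr0. Qed.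

Lemma Cc_restrict f C : clopen C -> Cc f -> Cc (restrict f C).
Proof.
move=> oC hf; apply: CcM => //; move=> c.
exact (@continuous_comp G (tpath A) R[i]^o (@rg _ T) (\1_C) c (@rg_continuous _ A c)
  (@continuous_indic _ R[i] C oC (rg c))).
Qed.

(** Requiring C to be clopen keeps the restricted functions in [Cc]. *)
Definition OA_stable C : Prop := clopen C /\
  forall f, Cc f -> OA iota (iota f) -> OA iota (iota (restrict f C)).

Lemma OA_stableT : OA_stable setT.
Proof.
split=> [|f hf h]; first exact: clopenT.
by have -> : restrict f setT = f by apply/funext => c; rewrite restrictT.
Qed.

Lemma OA_stableI C D : OA_stable C -> OA_stable D -> OA_stable (C `&` D).
Proof.
move=> [oC hC] [oD hD]; split=> [|f hf h]; first exact: clopenI.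
have -> : restrict f (C `&` D) = restrict (restrict f C) D.
  by apply/funext => c; rewrite /restrict -mulrA indicI.
by apply: hD; [exact: Cc_restrict|exact: hC].
Qed.

Lemma OA_stableC C : OA_stable C -> OA_stable (~` C).
Proof.
move=> [oC hC]; split=> [|f hf h]; first exact: clopenC.
have -> : restrict f (~` C) = fun c => f c - restrict f C c.
  apply/funext => c; have [Cc|nCc] := pselect (C (rg c)).
    by rewrite restrictF ?restrictT ?subrr //; apply/not_notP.
  by rewrite (restrictF _ nCc) restrictT // subr0.
by rewrite iotaB //; [apply: (clssB OA_subspace) => //; exact: hC|exact: Cc_restrict].
Qed.

(** Restriction to a cylinder is left multiplication by S_a P S_a^*, an element of O_A unless it is
    the unit; in that case the cylinder is the whole space. *)
Lemma OA_stable_cyl a e : OA_stable (cyl a e).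
Proof.
have [ae|ae] := pselect ((a, a, e) = ([::], [::], [::])).
  case: ae => -> _ ->; suff -> : cyl [::] [::] = setT :> set (tpath A) by exact: OA_stableT.
  by rewrite cyl0; apply/seteqP.
split=> [|f hf h]; first exact: cyl_clopen.
have -> : restrict f (cyl a e) = convol \1_(bis a a e) f by rewrite convol_diag.
rewrite (star_reprM hi) //; last exact: Cc_bis.
apply: (subcsM (OA_sub_cstar iota)) => //; exact: OA_bis.
Qed.

Lemma OA_stable_nbhs x (O : set (tpath A)) : nbhs x O -> exists C, [/\ OA_stable C, C x &
  C `<=` O].
Proof.
apply: (subbase_nbhs (@tpath_subbase _ A)); [exact: OA_stableT|exact: OA_stableI|].
have cle (V : set (tpath A)) : tpath_clopen V -> OA_stable V.
  by case=> a _ [->|[j ->]]; [rewrite -cyl0|rewrite -cyl1]; exact: OA_stable_cyl.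
by move=> W /= [/cle//|/cle/OA_stableC]; rewrite setCK.
Qed.

(* rg is a homeomorphism from bis a b e onto its image *)
Lemma bis_rg_nbhs a b e g (V : set G) : bis a b e g -> nbhs g V ->
  exists C, [/\ OA_stable C, C (rg g) & forall c, bis a b e c -> C (rg c) -> V c].
Proof.
move=> hg; rewrite nbhsE => -[V' [oV' V'g] V'V].
(* The part of the bisection outside V' has a compact, hence closed, image under [rg], and
   injectivity keeps the range of g out of it. *)
pose K := bis a b e `&` ~` V'.
have cK : compact K.
  by apply: compact_closedI; [exact: bis_compact|exact: open_closedC].
have cK' : compact (@rg _ T @` K).
  by apply: continuous_compact => //; apply: continuous_subspaceT; exact: rg_continuous.
have oK : open (~` (@rg _ T @` K)).
  by rewrite openC; apply: compact_closed cK'; exact: tpath_hausdorff.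
have nK : (~` (@rg _ T @` K)) (rg g).
  by move=> [h [hh nh] hgh]; apply: nh; rewrite (bis_rg_inj hh hg hgh).
have [C [sC Cg CK]] := OA_stable_nbhs (open_nbhs_nbhs (conj oK nK)).
exists C; split=> // c hc /CK nc; apply: V'V; apply: contrapT => nV'.
by apply: nc; exists c.
Qed.

(** Finitely many stable sets, on each of which f varies by at most d from its value at a chosen
    point, cover the ranges of the bisection. *)
Lemma step_approx a b e f (d : R[i]) : (a, b, e) <> ([::], [::], [::]) ->
  Cc f -> 0 < d -> exists s, [/\ Cc s, OA iota (iota s), forall c,
    ~ bis a b e c -> s c = 0 &
    forall c, bis a b e c -> `|f c - s c| <= d].
Proof.
move=> tau hf d0.
have loc g : exists C, bis a b e g ->
    [/\ OA_stable C, C (rg g) & forall c, bis a b e c -> C (rg c) -> `|f c - f g| <= d].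
  have [hg|ng] := pselect (bis a b e g); last by exists setT.
  have V : nbhs g [set c | `|f c - f g| <= d].
    have /cvgrPdist_le /(_ _ d0) := hf.1 g.
    by apply: filterS => c; rewrite distrC.
  by have [C [sC Cg CV]] := bis_rg_nbhs hg V; exists C.
have /choice[Cg HCg] := loc.
have [|g hg|s sW sC] := @compact_seq_cover G G (bis a b e) (fun g => @rg _ T @^-1` (Cg g)) _ (@bis_compact _ A a b e).
- by move=> g /HCg[[[oC _] _] _ _]; move/continuousP: (@rg_continuous _ A); apply.
- by exists g => //; have [] := HCg _ hg.
suff [t [ht At t0 td]] : exists t, [/\ Cc t, OA iota (iota t), forall c,
  ~ bis a b e c -> t c = 0 &
    forall c g, g \in s -> bis a b e c -> Cg g (rg c) -> `|f c - t c| <= d].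
  by exists t; split=> // c hc; have [g gs gc] := sC _ hc; exact: td gs hc gc.
elim: s sW {sC} => [_|g s IHs sW].
  exists (\1_set0); split=> [||c _|//]; last by rewrite indic0.
    by apply: Cc_indic => //; [exact: clopen0|exact: compact0].
  by rewrite (iota_set0 hi); exact: clss0 OA_subspace.
have [|t [ht At t0 td]] := IHs; first by move=> h hs; apply: sW; rewrite inE hs orbT.
have hg : bis a b e g by apply: sW; rewrite inE eqxx.
have [sC Cgg Cgd] := HCg _ hg.
pose t1 := restrict (\1_(bis a b e) : G -> R[i]) (Cg g).
have h1 : Cc t1 by apply: Cc_restrict; [exact: sC.1|exact: Cc_bis].
have A1 : OA iota (iota t1) by apply: sC.2; [exact: Cc_bis|exact: OA_bis].
have h2 : Cc (restrict t (~` Cg g)) by apply: Cc_restrict => //; exact: (OA_stableC sC).1.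
have A2 : OA iota (iota (restrict t (~` Cg g))) by apply: (OA_stableC sC).2.
(* On the new set the value becomes [f g]; elsewhere the step function t already built is kept. *)
exists (fun c => restrict t (~` Cg g) c + f g * t1 c); split.
- by apply: CcD => //; exact: CcZ.
- rewrite (star_reprD hi) //; last exact: CcZ.
  by rewrite (star_reprZ hi) //; apply: (clssD OA_subspace) => //;
    exact: (clssZ OA_subspace).
- by move=> c nc; rewrite /restrict t0 // mul0r /t1 /restrict [\1_(bis _ _ _) _]indicE memNset // mul0r mulr0 addr0.
move=> c h; rewrite inE => hs hc hC; have [Cgc|nCgc] := pselect (Cg g (rg c)).
  rewrite restrictF; last by move=> nC; exact: nC.
  by rewrite /t1 restrictT // indicE mem_set // mulr1 add0r; exact: Cgd.
rewrite restrictT // /t1 restrictF // mulr0 addr0.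
case/predU1P: hs hC => [-> //|hs hC]; exact: td hs hc hC.
Qed.

Lemma OA_bis_supp a b e f : (a, b, e) <> ([::], [::], [::]) -> Cc f ->
  (forall c, ~ bis a b e c -> f c = 0) -> OA iota (iota f).
Proof.
move=> tau hf f0; apply: closed_subspace_approx => // d d0.
set N := 2 * `|iota \1_(bis a b e)|.
have N0 : 0 <= N by rewrite mulr_ge0.
(* The tolerance is divided by N + 1 because N may be zero. *)
have N1 : 0 < N + 1 by rewrite ltr_wpDl.
have dN : 0 < d / (N + 1) by exact: divr_gt0.
have [s [hs As s0 sd]] := step_approx tau hf dN.
exists (iota s) => //; rewrite -iotaB //.
apply: (@le_trans _ _ (d / (N + 1) * N)).
  apply: (norm_iota_le hi dN) => [|c hc|c]; [exact: CcB|by rewrite f0 // s0 // subr0|].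
  have [/sd//|nc] := pselect (bis a b e c).
  by rewrite f0 // s0 // subr0 normr0 ltW.
by rewrite mulrAC ler_pdivrMr // ler_pM2l // lerDl.
Qed.

(** As the first bisection W is clopen, f 1_W stays in [Cc] and is supported in W, while f - f 1_W
    is supported in the others. *)
Lemma OA_cover f (s : seq (seq I * seq I * seq I)) : Cc f ->
  (forall t, t \in s -> t <> ([::], [::], [::])) ->
  (forall c, f c != 0 -> exists2 t, t \in s & bis t.1.1 t.1.2 t.2 c) -> OA iota (iota f).
Proof.
elim: s f => [|[[a b] e] s IHs] f hf tau supp.
  have -> : f = \1_set0.
    apply/funext => c; rewrite indic0; apply/eqP; apply/negP => /negP /supp[] //.
  by rewrite (iota_set0 hi); exact: clss0 OA_subspace.
have hW : Cc (fun c => f c * \1_(bis a b e) c).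
  by apply: CcM => //; exact (@continuous_indic G R[i] _ (@bis_clopen _ A a b e)).
have -> : f = fun c => f c * \1_(bis a b e) c + (f c - f c * \1_(bis a b e) c).
  by apply/funext => c; rewrite addrC subrK.
have hB := CcB hG hf hW.
rewrite (star_reprD hi) //; apply: (clssD OA_subspace).
  apply: (@OA_bis_supp a b e) => //; first by apply: tau; rewrite inE eqxx.
  by move=> c nc; rewrite indicE memNset // mulr0.
apply: IHs => // [t ts|c]; first by apply: tau; rewrite inE ts orbT.
rewrite indicE; have [hc|nc] := pselect (bis a b e c);
  first by rewrite mem_set // mulr1 subrr eqxx.
rewrite memNset // mulr0 subr0 => /supp[t]; rewrite inE => /predU1P[-> //|ts ht].
by exists t.
Qed.

(** The last hypothesis says that no range in K is the empty path together with the empty set. *)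
Lemma OA_compact_supp f (K : set G) : Cc f -> compact K -> (forall c, f c != 0 -> K c) ->
  (forall c, K c -> exists i, entry (rg c) 0 = Some i \/ Iset 0 (rg c) i) ->
    OA iota (iota f).
Proof.
move=> hf cK fK KY.
have [|g Kg|s sD sK] := @compact_seq_cover G _ [set t | t <> ([::], [::], [::])]
  (fun t : seq I * seq I * seq I => bis t.1.1 t.1.2 t.2) _ cK.
- by move=> t _; exact: bis_open.
- have [m [n [dg hg]]] := gpdP g; have [a [b [am bn gab]]] := bis_ex dg hg.
  have [ab|ab] := pselect ((a, b) = ([::], [::])); last first.
    by exists (a, b, [::]) => //= -[a0 b0]; apply: ab; rewrite a0 b0.
  (* Here g is a unit. It is caught by S_i S_i^* if its path begins with i, and by S_i^* S_i if i
     may precede its path. *)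
  case: ab gab => -> -> [_ _ dg0 [z [[rz] [sz]]]].
  have [i [gi|gi]] := KY _ Kg.
    have gs : starts_with [:: i] (rg g) by exact/starts_with1.
    exists ([:: i], [:: i], [::]) => //=; split; rewrite ?cyl0 //.
    + by rewrite sz -rz.
    + by rewrite sz -rz; have [w hw] := starts_piter gs; exists w.
  exists ([::], [::], [:: i]) => //=; split=> //; last by exists z; split; congr Some.
    by split=> // j; rewrite inE => /eqP ->.
  by split=> // j; rewrite inE => /eqP ->; rewrite sz -rz.
- by apply: (@OA_cover f s) => // c /fK /sK.
Qed.

End density.

(** * Restriction to an invariant open set *)

Section restriction.
Context (X : topologicalType) (T : X -> option X) (U : set X).
Hypothesis oU : open U.
Hypothesis invU : forall x y, T x = Some y -> U x <-> U y.
Hypothesis hG : hausdorff_space (gpd T).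
Hypothesis rgC : continuous (@rg X T).
Local Notation TU := (@prestrict X T U).
Local Notation G := (gpd T).
Local Notation GU := (gpd TU).
Local Notation incl := (@gpd_incl X T U).
Implicit Types (u v w : set_type U) (g : G) (h : GU).

Lemma set_val_inj : injective (@set_val _ U).
Proof. by move=> u v uv; apply: val_inj. Qed.

Lemma set_val_ex x : U x -> exists u, set_val u = x.
Proof. by move=> Ux; exists (SigSub (mem_set Ux)). Qed.

Lemma mem_set_val u : U (set_val u).
Proof. by have := valP u; rewrite inE. Qed.

(** By invariance the orbit stays in U, so that the partial map into the subtype is defined whenever
    T is. *)
Lemma piter_prestrict_inv n u y : piter T n (set_val u) = Some y ->
  exists2 w, piter TU n u = Some w & set_val w = y.
Proof.
elim: n y => [y [<-]|n IHn y]; first by exists u.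
rewrite piterS; case e: (piter T n _) => [y'|//] /= yy.
have [w uw wy] := IHn _ e; have Uy : U y by apply/(invU yy); rewrite -wy;
  exact: mem_set_val.
have [v vy] := set_val_ex Uy; exists v => //.
rewrite uw /= /prestrict wy yy /=; case: insubP => [v1 _ v1y|]; last by rewrite mem_set.
by congr Some; apply: set_val_inj; rewrite vy -v1y.
Qed.

Lemma piter_invU n x y : piter T n x = Some y -> U x <-> U y.
Proof.
elim: n y => [y [<-] //|n IHn y]; rewrite piterS; case e: (piter T n x) => [z|//] /= zy.
by rewrite (IHn _ e); exact: invU.
Qed.

Lemma gpd_invU g : U (rg g) <-> U (sr g).
Proof.
by have [m [n [_ [z [h1 h2]]]]] := gpdP g; rewrite (piter_invU h1) (piter_invU h2).
Qed.

Lemma piter_meet_prestrict m n u v : piter_meet TU m n u v <->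
  piter_meet T m n (set_val u) (set_val v).
Proof.
split=> -[z [h1 h2]]; first by exists (set_val z); split; exact: piter_prestrict.
have [w uw wz] := piter_prestrict_inv h1; have [w' vw wz'] := piter_prestrict_inv h2.
exists w; split=> //; rewrite vw; congr Some; apply: set_val_inj; by rewrite wz.
Qed.

Lemma gpd_incl_inj : injective incl.
Proof.
move=> h k [] hk1 hk2 hk3.
by apply: gpd_eq => //; exact: set_val_inj.
Qed.

Lemma gpd_incl_ex g : U (rg g) -> exists h, incl h = g.
Proof.
move=> Ug; have [u ug] := set_val_ex Ug; have [v vg] := set_val_ex ((gpd_invU g).1 Ug).
have [m [n [dg hg]]] := gpdP g.
have huv : piter_meet TU m n u v by apply/piter_meet_prestrict; rewrite ug vg.
by exists (Gpd (ex_intro _ m (ex_intro _ n (conj dg huv)))); apply: gpd_eq.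
Qed.

Lemma gpd_incl_rg h : U (rg (incl h)).
Proof. exact: mem_set_val. Qed.

Lemma set_val_continuous : continuous (@set_val _ U).
Proof. exact: initial_continuous. Qed.

Lemma gpd_incl_continuous : continuous (incl : GU -> G).
Proof.
apply: (subbase_continuous (@gpd_subbase _ T)) => _ [m [n [V [W [oV oW iV iW ->]]]]].
apply: (subbase_open (@gpd_subbase _ TU)).
exists m, n, (@set_val _ U @^-1` V), (@set_val _ U @^-1` W); split.
- by move/continuousP: set_val_continuous; apply.
- by move/continuousP: set_val_continuous; apply.
- move=> x y z Vx Vy /piter_prestrict xz /piter_prestrict yz.
  by apply: set_val_inj; exact: iV Vx Vy xz yz.
- move=> x y z Vx Vy /piter_prestrict xz /piter_prestrict yz.
  by apply: set_val_inj; exact: iW Vx Vy xz yz.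
apply/seteqP; split=> h /= [h1 h2 h3 h4]; split=> //; exact/piter_meet_prestrict.
Qed.

(** The inclusion is open: the sets with open image are stable under intersection, by injectivity,
    and contain the basic open sets, as an open subset of U comes from an open set met with U. *)
Lemma gpd_incl_nbhs h (O : set GU) : nbhs h O -> nbhs (incl h) (incl @` O).
Proof.
move=> hO; have [||W|C [oC Ch CO]] :=
  @subbase_nbhs _ _ [set C | open (incl @` C)] _ _ (@gpd_subbase _ TU) _ _ _ hO.
- rewrite /=; have -> : incl @` setT = @rg _ T @^-1` U.
    apply/seteqP; split=> [_ [k _ <-]|g /gpd_incl_ex[k <-]]; last by exists k.
    exact: gpd_incl_rg.
  by move/continuousP: rgC; apply.
- move=> C D /= oC oD; have -> : incl @` (C `&` D) = incl @` C `&` incl @` D.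
    apply/seteqP; split=> [_ [k [Ck Dk] <-]|_ [[k Ck <-] [k' Dk' /gpd_incl_inj kk]]].
      by split; exists k.
    by exists k => //; split=> //; rewrite -kk.
  exact: openI.
- move=> [m [n [V [W' [[V' oV' <-] [W2 oW2 <-] iV iW ->]]]]] /=.
  apply: (subbase_open (@gpd_subbase _ T)); exists m, n, (V' `&` U), (W2 `&` U).
  split; [exact: openI|exact: openI| | |].
  + move=> x y z [Vx Ux] [Vy Uy] xz yz.
    have [u ux] := set_val_ex Ux; have [v vy] := set_val_ex Uy.
    rewrite -ux in xz Vx *; rewrite -vy in yz Vy *.
    have [w uw wz] := piter_prestrict_inv xz; have [w' vw wz'] := piter_prestrict_inv yz.
    have ww : w = w' by apply: set_val_inj; rewrite wz.
    by rewrite -ww in vw; congr set_val; exact: iV uw vw.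
  + move=> x y z [Vx Ux] [Vy Uy] xz yz.
    have [u ux] := set_val_ex Ux; have [v vy] := set_val_ex Uy.
    rewrite -ux in xz Vx *; rewrite -vy in yz Vy *.
    have [w uw wz] := piter_prestrict_inv xz; have [w' vw wz'] := piter_prestrict_inv yz.
    have ww : w = w' by apply: set_val_inj; rewrite wz.
    by rewrite -ww in vw; congr set_val; exact: iW uw vw.
  apply/seteqP; split=> [_ [k [k1 k2 k3 k4] <-]|g [[g1 g2] [g3 g4] g5 g6]].
    by split=> //=; [split=> //; exact: mem_set_val|split=> //;
      exact: mem_set_val|exact/piter_meet_prestrict].
  have [k kg] := gpd_incl_ex g2; exists k => //; rewrite -kg in g1 g3 g5 g6.
  by split=> //; exact/piter_meet_prestrict.
rewrite nbhsE; exists (incl @` C); first by split=> //; exists h.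
by move=> _ [k Ck <-]; exists k => //; exact: CO.
Qed.

Lemma gpd_prestrict_hausdorff : hausdorff_space GU.
Proof.
move=> h k hk; apply: gpd_incl_inj; apply: hG.
by apply: cluster_continuous hk; exact: gpd_incl_continuous.
Qed.

(** The image of an ultrafilter converges in W to a point of the smaller groupoid, and openness of
    the inclusion lifts the convergence. *)
Lemma gpd_incl_preimage_compact (W : set G) : compact W -> W `<=` [set g | U (rg g)] ->
  compact (incl @^-1` W).
Proof.
rewrite !compact_ultra => cW WU F FU FW.
have [p [Wp Fp]] := cW (incl @ F) (ultra_fmap _ FU) FW.
have [h hp] := gpd_incl_ex (WU _ Wp); exists h; split; first by rewrite /= hp.
move=> O /gpd_incl_nbhs; rewrite hp => /Fp.
by apply: (@filterS _ F) => k [k' Ok' /gpd_incl_inj <-].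
Qed.

Context (R : realType).
Implicit Types (f : GU -> R[i]).

Lemma extend0_incl f h : extend0 f (incl h) = f h.
Proof.
rewrite /extend0 -[RHS](@fsbig_set1 _ _ (+%R : Monoid.com_law 0) _ h f).
by congr (\sum_(_ \in _) _); apply/seteqP; split=> k /= => [/gpd_incl_inj|->].
Qed.

Lemma extend0_out f g : ~ U (rg g) -> extend0 f g = 0.
Proof. by move=> nU; apply: fsbig1 => k /= kg; exfalso; apply: nU; rewrite -kg;
  exact: gpd_incl_rg. Qed.

(** The operation F stands for the sum or for a scalar multiple. *)
Lemma extend0_lin f f' (F : R[i] -> R[i] -> R[i]) : F 0 0 = 0 ->
  extend0 (fun h => F (f h) (f' h)) = fun g => F (extend0 f g) (extend0 f' g).
Proof.
move=> F0; apply/funext => g; have [/gpd_incl_ex[h <-]|nU] := pselect (U (rg g)).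
  by rewrite !extend0_incl.
by rewrite !extend0_out.
Qed.

Lemma extend0_supp f : Cc f ->
  exists K : set G, [/\ compact K, forall g, extend0 f g != 0 -> K g &
    K `<=` [set g | U (rg g)]].
Proof.
move=> hf; have [K cK fK] := Cc_supp hf; exists (incl @` K); split.
- by apply: continuous_compact => //; apply: continuous_subspaceT;
  exact: gpd_incl_continuous.
- move=> g; have [/gpd_incl_ex[h <-]|nU] := pselect (U (rg g));
  last by rewrite extend0_out ?eqxx.
  by rewrite extend0_incl => /fK Kh; exists h.
- by move=> _ [h _ <-]; exact: gpd_incl_rg.
Qed.

(** Over U, continuity follows from the openness of the inclusion; elsewhere the complement of the
    compact set K is a neighbourhood on which the extension vanishes. *)
Lemma Cc_extend0 f : Cc f -> Cc (extend0 f).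
Proof.
move=> hf; have [K [cK fK KU]] := extend0_supp hf;
  apply: (@Cc_intro _ _ _ hG _ K _ cK fK) => g.
have [/gpd_incl_ex[h <-]|nU] := pselect (U (rg g)).
  move=> V; rewrite extend0_incl => /(hf.1 h) /= hV.
  by apply: filterS (gpd_incl_nbhs hV) => _ [k Vk <-] /=; rewrite extend0_incl.
move=> V; rewrite extend0_out // => V0.
have oK : open (~` K) by rewrite openC; exact: (compact_closed hG cK).
have nK : (~` K) g by move=> /KU.
apply: filterS (open_nbhs_nbhs (conj oK nK)) => k nKk /=.
have -> : extend0 f k = 0 by apply/eqP; apply/negP => /negP /fK.
exact: nbhs_singleton V0.
Qed.

Lemma indic_extend0 (W : set G) : clopen W -> compact W -> W `<=` [set g | U (rg g)] ->
  exists2 f : GU -> R[i], Cc f & extend0 f = \1_W.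
Proof.
move=> oW cW WU; exists (\1_(incl @^-1` W)).
  apply: Cc_indic; first exact: gpd_prestrict_hausdorff.
    by apply: preimage_clopen => // ; exact: gpd_incl_continuous.
  exact: gpd_incl_preimage_compact.
apply/funext => g; have [/gpd_incl_ex[h <-]|nU] := pselect (U (rg g)).
  by rewrite extend0_incl !indicE.
by rewrite extend0_out // indicE memNset // => /WU.
Qed.

End restriction.

Lemma closure_subspace (R : realType) (B : cstarAlgebraType R) (S : set B) :
  S 0 -> (forall x y, S x -> S y -> S (x + y)) -> (forall (r : R[i]) x,
    S x -> S (r *: x)) ->
  closed_subspace (closure S).
Proof.
move=> S0 SD SZ.
have clP x : closure S x <-> forall d : R[i], 0 < d -> exists2 y, S y & `|x - y| < d.
  split=> [clx d d0|h V /nbhs_ballP[d /= d0 dV]].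
    have [y [Sy xy]] := clx _ (nbhsx_ballx x d d0).
    by exists y => //; rewrite -ball_normE in xy.
  by have [y Sy xy] := h d d0; exists y; split=> //; apply: dV; rewrite -ball_normE.
split.
- exact: closed_closure.
- exact: subset_closure.
- move=> x y /clP Sx /clP Sy; apply/clP => d d0.
  have d2 : 0 < d / 2 by exact: divr_gt0.
  have [x' Sx' xx] := Sx _ d2; have [y' Sy' yy] := Sy _ d2.
  exists (x' + y'); first exact: SD.
  rewrite opprD addrACA; apply: le_lt_trans (ler_normD _ _) _.
  by rewrite [ltRHS](splitr d) ltrD.
- move=> r x /clP Sx; have [->|r0] := eqVneq r 0.
    by rewrite scale0r; exact: subset_closure.
  apply/clP => d d0; have dr : 0 < d / `|r| by rewrite divr_gt0 // normr_gt0.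
  have [y Sy xy] := Sx _ dr; exists (r *: y); first exact: SZ.
  by rewrite -scalerBr normrZ mulrC -ltr_pdivlMr // normr_gt0.
Qed.

(** * The complement of the empty path and its ideal *)

Section empty_path.
Context (I : choiceType) (A : rel I) (h : JA A set0).
Implicit Types (x y : tpath A).

Lemma neq_empty_tpathP x : x <> empty_tpath h <-> exists i,
  entry x 0 = Some i \/ Iset 0 x i.
Proof.
split=> [nx|[i hi] xE]; last by case: hi; rewrite xE.
apply: contrapT => nE; apply: nx; case x0: (entry x 0) => [i|].
  by exfalso; apply: nE; exists i; left.
apply: tpath_ext => k; first by rewrite (entry_None (leq0n k) x0) /= onth0n.
rewrite (Iset_None (leq0n k) x0) /= onth0n.
by apply/seteqP; split=> // i xi; exfalso; apply: nE; exists i; right.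
Qed.

(** The first entry of x belongs to the set [Iset 0] of its shift, which is thus never the empty
    path. *)
Lemma shift_neq_empty x y : tpath_shift x = Some y ->
  [set~ empty_tpath h] x <-> [set~ empty_tpath h] y.
Proof.
move=> xy; have [i xi] : exists i, entry x 0 = Some i.
  by case x0: (entry x 0) => [i|]; [exists i|move/shift_None: x0; rewrite xy].
split=> _ /=; apply/neq_empty_tpathP; exists i; last by left.
by right; rewrite (shift_entry xy).2; exact: Iset_last.
Qed.

Lemma bis_neq_empty a b e : (a, b, e) <> ([::], [::], [::]) ->
  bis a b e `<=` [set g | [set~ empty_tpath h] (rg g)].
Proof.
move=> tau g [[ga ge] [gb _] _ [z [h1 h2]]] /=; apply/neq_empty_tpathP.
case: a tau ga ge h1 => [|i a] tau ga ge h1; last by exists i; left; rewrite ga.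
case: e tau ge => [|j e] tau ge; last by exists j; right; apply: ge; rewrite inE eqxx.
(* With a and e empty, the range is an iterated shift of the source, which begins with a letter of
   b; the complement of the empty path is invariant. *)
case: b tau gb h2 => [//|i b] _ gb h2; apply/neq_empty_tpathP.
have [->] := h1; apply/(piter_invU shift_neq_empty h2)/neq_empty_tpathP.
by exists i; left; rewrite gb.
Qed.

End empty_path.

Section ideal.
Context (R : realType) (I : choiceType) (A : rel I) (h : JA A set0).
Local Notation T := (@tpath_shift I A).
Local Notation U := [set~ empty_tpath h].
Context (B : cstarAlgebraType R) (iota : (gpd T -> R[i]) -> B).
Hypothesis hi : star_repr iota.

Let oU : open U.
Proof.
by rewrite openC; apply: accessible_closed_set1; apply: hausdorff_accessible;
  exact: tpath_hausdorff.
Qed.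

Let invU := @shift_neq_empty I A h.
Let hG := @gpd_hausdorff I A.
Let rgC := @rg_continuous I A.
Let CcE := @Cc_extend0 _ _ _ oU invU hG rgC R.
Let hGU := @gpd_prestrict_hausdorff _ _ _ invU hG.

Lemma cstar_ideal_subspace : closed_subspace (cstar_ideal iota U).
Proof.
apply: closure_subspace.
- exists (fun _ => 0); first exact: (@Cc0 R _ _ hGU).
  suff -> : extend0 (fun _ : gpd (@prestrict _ T U) => 0) = \1_set0 :> (gpd T -> R[i]).
    exact: iota_set0.
  by apply/funext => g; rewrite indic0; apply: fsbig1.
- move=> _ _ [f hf <-] [f' hf' <-]; exists (fun c => f c + f' c); first exact: CcD.
  by rewrite (extend0_lin invU _ _ (F := +%R)) ?addr0 // (star_reprD hi) //; exact: CcE.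
- move=> r _ [f hf <-]; exists (fun c => r * f c); first exact: CcZ.
  rewrite (extend0_lin invU f f (F := fun x _ => r * x)) ?mulr0 // (star_reprZ hi) //.
  exact: CcE.
Qed.

(** The bisections spanning O_A avoid the empty path, so their indicators are extensions by zero;
    conversely an extension by zero has compact support away from the empty path. *)
Lemma OA_ideal : OA iota = cstar_ideal iota U.
Proof.
apply/seteqP; split=> u.
  move/(OA_sub_span hi); apply: span_bis_sub => [|a b e tau];
    first exact: cstar_ideal_subspace.
  have [f hf <-] := @indic_extend0 _ _ _ oU invU hG rgC R _ (@bis_clopen _ A a b e)
    (@bis_compact _ A a b e) (bis_neq_empty tau).
  by apply: subset_closure; exists f.
have /closure_id -> := subcs_closed (OA_sub_cstar iota).
apply: closureS => _ [f hf <-].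
have [K [cK fK KU]] := extend0_supp invU hf.
by apply: (OA_compact_supp hi (CcE hf) cK fK) => c /KU /neq_empty_tpathP.
Qed.

End ideal.

Theorem proposition4p8 (R : realType) (I : countType) (A : rel I)
    (hA : forall i : I, exists j : I, A i j)
    (B : cstarAlgebraType R) (iota : (gpd (@tpath_shift I A) -> R[i]) -> B)
    (hB : full_cstar iota) :
  (~ JA A set0 -> OA iota = [set: B]) /\
  (forall h : JA A set0, OA iota = cstar_ideal iota [set~ empty_tpath h]).
Proof.
have hi := full_repr hB; split=> [nJ|h]; last exact: OA_ideal.
apply/seteqP; split=> // u _.
have /closure_id -> := subcs_closed (OA_sub_cstar iota).
have : closure (iota @` Cc) u by rewrite (full_dense hB).
apply: closureS => _ [f hf <-]; have [K cK fK] := Cc_supp hf.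
apply: (OA_compact_supp hi hf cK fK) => c _.
(* Every point qualifies: a path without entries carries a set in [JA], which is not empty by
   assumption. *)
case c0: (entry (rg c) 0) => [i|]; first by exists i; left.
suff /set0P[i hi0] : Iset 0 (rg c) != set0 by exists i; right.
by apply/eqP => cJ; apply: nJ; rewrite -cJ; exact: Iset_JA.
Qed.
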